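(* Let $k$ be a field and let $A$ and $B$ be commutative Noetherian $k$-algebras such that $R = A\otimes_k B$ is Noetherian. Let $I\subseteq A$ and $J\subseteq B$ be nonzero proper ideals. Then for every integer $n\ge 1$, $$(I+J)^{(n)} = \sum_{i+j=n} I^{(i)}J^{(j)},$$ where the sum runs over all integers $i,j\ge 0$ with $i+j=n$.
   Context: For an ideal $Q$ of a commutative Noetherian ring $S$ and $n\ge 1$, the $n$-th symbolic power of $Q$ is $Q^{(n)} = S\cap \bigcap_{P\in \operatorname{Min}(Q)} Q^nS_P$, where $\operatorname{Min}(Q)$ is the set of minimal primes of $Q$ and the intersection with $S$ means the set of elements of $S$ whose image in $S_P$ lies in $Q^nS_P$ for every $P\in\operatorname{Min}(Q)$. By convention $Q^{(0)}=S$. The symbolic powers $I^{(i)}$ and $J^{(j)}$ are formed in $A$ and $B$ respectively; ideals of $A$ and of $B$ are denoted by the same symbol as their extensions to $R$, so $I+J$ and $I^{(i)}J^{(j)}$ are the sum and product of the extended ideals in $R$, and $(I+J)^{(n)}$ is a symbolic power in $R$. *)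

(* Defs.v *)
From HB Require Import structures.
From mathcomp Require Import all_boot all_algebra generic_quotient ring.
From mathcomp Require Import all_classical.

Set Implicit Arguments.
Unset Strict Implicit.
Unset Printing Implicit Defensive.

Import GRing.Theory.

Local Open Scope classical_set_scope.
Local Open Scope ring_scope.
Local Open Scope quotient_scope.

Declare Scope ideal_scope.
Delimit Scope ideal_scope with I.

(** * Ideals *)

(** The ideals of MathComp ([idealr]) are proper; the unit ideal is needed here
    (it is the zeroth power of every ideal), hence this definition. *)
Definition is_ideal (S : comPzRingType) (Q : set S) : Prop :=
  [/\ Q 0, forall x y, Q x -> Q y -> Q (x + y) & forall a x, Q x -> Q (a * x)].

Definition ideal_gen (S : comPzRingType) (X : set S) : set S :=
  smallest (@is_ideal S) X.

Definition noetherian (S : comPzRingType) : Prop :=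
  forall Q : set S, is_ideal Q -> exists s : seq S, Q = ideal_gen [set` s].

Definition ideal_add (S : comPzRingType) (Q Q' : set S) : set S :=
  [set x + y | x in Q & y in Q'].

Definition ideal_mul (S : comPzRingType) (Q Q' : set S) : set S :=
  ideal_gen [set x * y | x in Q & y in Q'].

Definition ideal_exp (S : comPzRingType) (Q : set S) (n : nat) : set S :=
  iter n (ideal_mul Q) setT.

Definition ideal_ext (S T : comPzRingType) (f : S -> T) (Q : set S) : set T :=
  ideal_gen (f @` Q).

Notation "Q + Q'" := (ideal_add Q Q') : ideal_scope.
Notation "Q * Q'" := (ideal_mul Q Q') : ideal_scope.
Notation "Q ^+ n" := (ideal_exp Q n) : ideal_scope.
Notation "\sum_ ( i < n ) Q" :=
  (\big[@ideal_add _/[set 0]]_(i < n) Q%I) : ideal_scope.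

Record prime_ideal (S : comPzRingType) := PrimeIdeal {
  prime_set :> set S;
  prime_is_ideal : is_ideal prime_set;
  prime_not1 : ~ prime_set 1;
  prime_mul : forall x y,
    prime_set (x * y) -> prime_set x \/ prime_set y }.

Definition minimal_primes (S : comPzRingType) (Q : set S) :
    set (prime_ideal S) :=
  [set P : prime_ideal S | Q `<=` P /\
    forall P' : prime_ideal S, Q `<=` P' -> P' `<=` P -> P' = P :> set S].

(** * Localization at a prime ideal *)

Section Localization.
Variables (S : comPzRingType) (P : prime_ideal S).

Record denom := Denom { dval : S; dvalP : dval \notin (P : set S) }.
HB.instance Definition _ := [isSub for dval].
HB.instance Definition _ := [Choice of denom by <:].

Lemma denom1_subproof : (1 : S) \notin (P : set S).
Proof. by rewrite notin_setE; exact: prime_not1. Qed.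

Lemma denomM_subproof (s t : denom) : dval s * dval t \notin (P : set S).
Proof.
rewrite notin_setE => /prime_mul [].
  by have := dvalP s; rewrite notin_setE.
by have := dvalP t; rewrite notin_setE.
Qed.

Definition denom1 : denom := Denom denom1_subproof.
Definition denomM (s t : denom) : denom := Denom (denomM_subproof s t).

Lemma denomE :
  (dval denom1 = 1) * (forall s t, dval (denomM s t) = dval s * dval t).
Proof. by []. Qed.

Implicit Types (x y z : S * denom).

Definition frac_eqv : rel (S * denom) := fun x y =>
  `[< exists u : denom, dval u * (x.1 * dval y.2) = dval u * (y.1 * dval x.2) >].

Lemma frac_eqv_refl : reflexive frac_eqv.
Proof. by move=> x; apply/asboolP; exists denom1. Qed.

Lemma frac_eqv_sym : symmetric frac_eqv.
Proof. by move=> x y; apply/asboolP/asboolP => -[u e]; exists u. Qed.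

Lemma frac_eqv_trans : transitive frac_eqv.
Proof.
move=> y x z /asboolP[u e] /asboolP[v f]; apply/asboolP.
exists (denomM (denomM u v) y.2); rewrite !denomE.
transitivity (dval v * dval z.2 * (dval u * (x.1 * dval y.2))); first by ring.
rewrite e.
transitivity (dval u * dval x.2 * (dval v * (y.1 * dval z.2))); first by ring.
by rewrite f; ring.
Qed.

Canonical frac_eqv_equiv :=
  EquivRel frac_eqv frac_eqv_refl frac_eqv_sym frac_eqv_trans.

(** The local ring [S_P]: fractions [a / s] with [s] outside [P], where
    [a / s = b / t] iff [u * a * t = u * b * s] for some [u] outside [P]. *)
Definition localization := {eq_quot frac_eqv}.
HB.instance Definition _ := Choice.on localization.
HB.instance Definition _ := EqQuotient.on localization.

Definition mkfrac (a : S) (s : denom) : localization := \pi_localization (a, s).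

Lemma eq_mkfrac a s b t : mkfrac a s = mkfrac b t <->
  exists u : denom, dval u * (a * dval t) = dval u * (b * dval s).
Proof. by split=> [/eqmodP/asboolP//|e]; apply/eqmodP/asboolP. Qed.

Lemma mkfracP (q : localization) : exists a s, q = mkfrac a s.
Proof. by exists (repr q).1, (repr q).2; rewrite /mkfrac -surjective_pairing reprK. Qed.

Definition loc_lift (T : Type) (f : S -> denom -> T) (q : localization) : T :=
  f (repr q).1 (repr q).2.

Lemma loc_liftE T (f : S -> denom -> T) :
  (forall a s b t, mkfrac a s = mkfrac b t -> f a s = f b t) ->
  forall a s, loc_lift f (mkfrac a s) = f a s.
Proof. by move=> fE a s; apply: fE; rewrite /mkfrac -surjective_pairing reprK. Qed.

Definition loc_opp := loc_lift (fun a s => mkfrac (- a) s).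
Definition loc_add (p q : localization) := loc_lift (fun a s =>
  loc_lift (fun b t => mkfrac (a * dval t + b * dval s) (denomM s t)) q) p.
Definition loc_mul (p q : localization) := loc_lift (fun a s =>
  loc_lift (fun b t => mkfrac (a * b) (denomM s t)) q) p.

Lemma loc_oppE a s : loc_opp (mkfrac a s) = mkfrac (- a) s.
Proof.
apply: loc_liftE => {}a {}s b t /eq_mkfrac[u e]; apply/eq_mkfrac; exists u.
by rewrite !mulNr !mulrN e.
Qed.

Lemma loc_addE a s b t : loc_add (mkfrac a s) (mkfrac b t) =
  mkfrac (a * dval t + b * dval s) (denomM s t).
Proof.
have E c r : loc_lift (fun b t => mkfrac (c * dval t + b * dval r) (denomM r t))
    (mkfrac b t) = mkfrac (c * dval t + b * dval r) (denomM r t).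
  apply: loc_liftE => a1 s1 a2 s2 /eq_mkfrac[u e].
  apply/eq_mkfrac; exists u; rewrite !denomE.
  transitivity (dval u * (c * dval s1 * dval r * dval s2) +
    dval r * dval r * (dval u * (a1 * dval s2))); first by ring.
  by rewrite e; ring.
rewrite /loc_add loc_liftE ?E// => a1 s1 a2 s2 /eq_mkfrac[u e].
rewrite !E; apply/eq_mkfrac; exists u; rewrite !denomE.
transitivity (dval u * (b * dval s1 * dval s2 * dval t) +
  dval t * dval t * (dval u * (a1 * dval s2))); first by ring.
by rewrite e; ring.
Qed.

Lemma loc_mulE a s b t :
  loc_mul (mkfrac a s) (mkfrac b t) = mkfrac (a * b) (denomM s t).
Proof.
have E c r : loc_lift (fun b t => mkfrac (c * b) (denomM r t)) (mkfrac b t) =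
    mkfrac (c * b) (denomM r t).
  apply: loc_liftE => a1 s1 a2 s2 /eq_mkfrac[u e].
  apply/eq_mkfrac; exists u; rewrite !denomE.
  transitivity (c * dval r * (dval u * (a1 * dval s2))); first by ring.
  by rewrite e; ring.
rewrite /loc_mul loc_liftE ?E// => a1 s1 a2 s2 /eq_mkfrac[u e].
rewrite !E; apply/eq_mkfrac; exists u; rewrite !denomE.
transitivity (b * dval t * (dval u * (a1 * dval s2))); first by ring.
by rewrite e; ring.
Qed.

Lemma loc_addA : associative loc_add.
Proof.
move=> p q r; have [[a [s ->]] [b [t ->]] [c [w ->]]] :=
  And3 (mkfracP p) (mkfracP q) (mkfracP r).
by rewrite !loc_addE; apply/eq_mkfrac; exists denom1; rewrite !denomE; ring.
Qed.

Lemma loc_addC : commutative loc_add.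
Proof.
move=> p q; have [[a [s ->]] [b [t ->]]] := conj (mkfracP p) (mkfracP q).
by rewrite !loc_addE; apply/eq_mkfrac; exists denom1; rewrite !denomE; ring.
Qed.

Lemma loc_add0 : left_id (mkfrac 0 denom1) loc_add.
Proof.
move=> p; have [a [s ->]] := mkfracP p.
by rewrite !loc_addE; apply/eq_mkfrac; exists denom1; rewrite !denomE; ring.
Qed.

Lemma loc_addN : left_inverse (mkfrac 0 denom1) loc_opp loc_add.
Proof.
move=> p; have [a [s ->]] := mkfracP p.
by rewrite loc_oppE !loc_addE; apply/eq_mkfrac; exists denom1; rewrite !denomE; ring.
Qed.

HB.instance Definition _ := GRing.isZmodule.Build localization
  loc_addA loc_addC loc_add0 loc_addN.

Lemma loc_mulA : associative loc_mul.
Proof.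
move=> p q r; have [[a [s ->]] [b [t ->]] [c [w ->]]] :=
  And3 (mkfracP p) (mkfracP q) (mkfracP r).
by rewrite !loc_mulE; apply/eq_mkfrac; exists denom1; rewrite !denomE; ring.
Qed.

Lemma loc_mulC : commutative loc_mul.
Proof.
move=> p q; have [[a [s ->]] [b [t ->]]] := conj (mkfracP p) (mkfracP q).
by rewrite !loc_mulE; apply/eq_mkfrac; exists denom1; rewrite !denomE; ring.
Qed.

Lemma loc_mul1 : left_id (mkfrac 1 denom1) loc_mul.
Proof.
move=> p; have [a [s ->]] := mkfracP p.
by rewrite !loc_mulE; apply/eq_mkfrac; exists denom1; rewrite !denomE; ring.
Qed.

Lemma loc_mulD : left_distributive loc_mul loc_add.
Proof.
move=> p q r; have [[a [s ->]] [b [t ->]] [c [w ->]]] :=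
  And3 (mkfracP p) (mkfracP q) (mkfracP r).
rewrite !(loc_addE, loc_mulE); apply/eq_mkfrac; exists denom1; rewrite !denomE; ring.
Qed.

HB.instance Definition _ := GRing.Zmodule_isComPzRing.Build localization
  loc_mulA loc_mulC loc_mul1 loc_mulD.

Definition loc_map (a : S) : localization := mkfrac a denom1.

Lemma loc_map_is_zmod_morphism : zmod_morphism loc_map.
Proof.
move=> a b; rewrite /loc_map; apply/esym.
rewrite [LHS](congr1 (loc_add _) (loc_oppE _ _)) loc_addE.
by apply/eq_mkfrac; exists denom1; rewrite !denomE; ring.
Qed.

Lemma loc_map_is_monoid_morphism : monoid_morphism loc_map.
Proof.
split=> // a b; apply/esym; rewrite [LHS]loc_mulE.
by apply/eq_mkfrac; exists denom1; rewrite !denomE; ring.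
Qed.

HB.instance Definition _ :=
  GRing.isZmodMorphism.Build S localization loc_map loc_map_is_zmod_morphism.
HB.instance Definition _ :=
  GRing.isMonoidMorphism.Build S localization loc_map loc_map_is_monoid_morphism.

End Localization.

Definition symbolic_power (S : comPzRingType) (Q : set S) (n : nat) : set S :=
  if n is 0 then setT else
  \bigcap_(P in minimal_primes Q)
    (@loc_map S P @^-1` ideal_ext (@loc_map S P) (Q ^+ n)%I).

Notation "Q ^( n )" := (symbolic_power Q n)
  (at level 1, format "Q ^( n )") : ideal_scope.

(** * Tensor product of two commutative algebras *)

Section Tensor.
Variables (k : comNzRingType) (A B : comAlgType k).

(** A list of pairs stands for the formal sum of the pure tensors [a (x) b];
    [tensor_cong] is the congruence generated by the commutation of the terms
    and by the bilinearity relations. *)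
Inductive tensor_cong : seq (A * B) -> seq (A * B) -> Prop :=
| tc_refl s : tensor_cong s s
| tc_sym s t : tensor_cong s t -> tensor_cong t s
| tc_trans s t u : tensor_cong s t -> tensor_cong t u -> tensor_cong s u
| tc_cat s t s' t' : tensor_cong s t -> tensor_cong s' t' ->
    tensor_cong (s ++ s') (t ++ t')
| tc_catC s t : tensor_cong (s ++ t) (t ++ s)
| tc_0l b : tensor_cong [:: (0, b)] [::]
| tc_0r a : tensor_cong [:: (a, 0)] [::]
| tc_Dl a a' b : tensor_cong [:: (a + a', b)] [:: (a, b); (a', b)]
| tc_Dr a b b' : tensor_cong [:: (a, b + b')] [:: (a, b); (a, b')]
| tc_Z c a b : tensor_cong [:: (c *: a, b)] [:: (a, c *: b)].

Definition tensor_eqv : rel (seq (A * B)) := fun s t => `[< tensor_cong s t >].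

Lemma tensor_eqv_refl : reflexive tensor_eqv.
Proof. by move=> s; apply/asboolP/tc_refl. Qed.

Lemma tensor_eqv_sym : symmetric tensor_eqv.
Proof. by move=> s t; apply/asboolP/asboolP; apply: tc_sym. Qed.

Lemma tensor_eqv_trans : transitive tensor_eqv.
Proof.
by move=> t s u /asboolP st /asboolP tu; apply/asboolP; apply: tc_trans tu.
Qed.

Canonical tensor_eqv_equiv :=
  EquivRel tensor_eqv tensor_eqv_refl tensor_eqv_sym tensor_eqv_trans.

Definition tensor := {eq_quot tensor_eqv}.
HB.instance Definition _ := Choice.on tensor.
HB.instance Definition _ := EqQuotient.on tensor.

Definition tsum (s : seq (A * B)) : tensor := \pi_tensor s.

Lemma eq_tsum s t : tsum s = tsum t <-> tensor_cong s t.
Proof. by split=> [/eqmodP/asboolP//|e]; apply/eqmodP/asboolP. Qed.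

Lemma tsumP (q : tensor) : exists s, q = tsum s.
Proof. by exists (repr q); rewrite /tsum reprK. Qed.

Lemma tc_repr s : tensor_cong (repr (tsum s)) s.
Proof. by apply/eq_tsum; rewrite /tsum reprK. Qed.

Lemma tc_perm (s t : seq (A * B)) : perm_eq s t -> tensor_cong s t.
Proof.
move=> st; elim: s t st => [|x s IHs] t.
  by rewrite perm_sym => /perm_nilP ->; exact: tc_refl.
move=> xst; have /splitPr xt : x \in t by rewrite -(perm_mem xst) mem_head.
case: xt xst => t1 t2 xst.
have st : perm_eq s (t1 ++ t2).
  by rewrite -(perm_cons x) (permPl xst) perm_catC /= perm_cons perm_catC.
apply: (@tc_trans _ ([:: x] ++ (t1 ++ t2))).
  exact: (tc_cat (tc_refl [:: x]) (IHs _ st)).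
rewrite -[x :: t2]cat1s !catA; apply: tc_cat; last exact: tc_refl.
exact: tc_catC.
Qed.

Lemma tc_map (f : {linear A -> A}) (g : {linear B -> B}) s t :
  tensor_cong s t ->
  tensor_cong [seq (f x.1, g x.2) | x <- s] [seq (f x.1, g x.2) | x <- t].
Proof.
elim=> {s t} /=.
- by move=> s; exact: tc_refl.
- by move=> s t _; exact: tc_sym.
- by move=> s t u _ st _; exact: tc_trans.
- by move=> s t s' t' _ st _ st'; rewrite !map_cat; exact: tc_cat.
- by move=> s t; rewrite !map_cat; exact: tc_catC.
- by move=> b; rewrite linear0; exact: tc_0l.
- by move=> a; rewrite linear0; exact: tc_0r.
- by move=> a a' b; rewrite linearD; exact: tc_Dl.
- by move=> a b b'; rewrite linearD; exact: tc_Dr.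
- by move=> c a b; rewrite !linearZ; exact: tc_Z.
Qed.

Definition seq_opp (s : seq (A * B)) := [seq (- x.1, x.2) | x <- s].
Definition seq_mul (s t : seq (A * B)) :=
  [seq (x.1 * y.1, x.2 * y.2) | x <- s, y <- t].

Lemma tc_opp s t : tensor_cong s t -> tensor_cong (seq_opp s) (seq_opp t).
Proof. exact: (tc_map (-%R : {linear A -> A}) (idfun : {linear B -> B})). Qed.

Lemma tc_mulr s t t' :
  tensor_cong t t' -> tensor_cong (seq_mul s t) (seq_mul s t').
Proof.
move=> tt'; elim: s => [|x s IHs]; first exact: tc_refl.
exact: (tc_cat (tc_map
  (GRing.mull_fun x.1 idfun : {linear A -> A})
  (GRing.mull_fun x.2 idfun : {linear B -> B}) tt') IHs).
Qed.

Lemma tc_mulC s t : tensor_cong (seq_mul s t) (seq_mul t s).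
Proof.
elim: s => [|x s IHs].
  by elim: t => [|y t IHt]; [exact: tc_refl|exact: IHt].
apply: (tc_trans (tc_cat (tc_refl _) IHs)); apply: tc_sym.
apply: (@tc_trans _ (seq_mul t [:: x] ++ seq_mul t s)).
  apply: tc_perm; rewrite /seq_mul -[x :: s]cat1s.
  by rewrite (perm_allpairs_catr _ _ (fun=> [:: x]) (fun=> s)).
apply: tc_cat; last exact: tc_refl.
rewrite /seq_mul allpairs1r.
under eq_map do rewrite mulrC [X in (_, X)]mulrC.
exact: tc_refl.
Qed.

Lemma tc_mul s t s' t' : tensor_cong s t -> tensor_cong s' t' ->
  tensor_cong (seq_mul s s') (seq_mul t t').
Proof.
move=> st st'; apply: (tc_trans (tc_mulr s st')).
by apply: (tc_trans (tc_mulC _ _)); apply: (tc_trans (tc_mulr _ st)); exact: tc_mulC.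
Qed.

Lemma seq_mulDl s t u : seq_mul (s ++ t) u = seq_mul s u ++ seq_mul t u.
Proof. exact: allpairs_cat. Qed.

Lemma seq_mulA s t u : seq_mul s (seq_mul t u) = seq_mul (seq_mul s t) u.
Proof.
elim: s => [//|x s IHs].
rewrite -[x :: s]cat1s !(seq_mulDl [:: x] s) IHs.
rewrite (seq_mulDl (seq_mul [:: x] t)); congr (_ ++ _).
have D s1 s2 : seq_mul [:: x] (s1 ++ s2) = seq_mul [:: x] s1 ++ seq_mul [:: x] s2.
  by rewrite /seq_mul /= !cats0 map_cat.
elim: t {IHs} => [//|y t IHt].
rewrite -[y :: t]cat1s (D [:: y] t) (seq_mulDl [:: y] t) D.
rewrite (seq_mulDl (seq_mul [:: x] [:: y])) IHt.
congr (_ ++ _).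
rewrite /seq_mul /= !cats0 -map_comp; apply: eq_map => z /=.
by rewrite !mulrA.
Qed.

Definition tensor_opp (p : tensor) := tsum (seq_opp (repr p)).
Definition tensor_add (p q : tensor) := tsum (repr p ++ repr q).
Definition tensor_mul (p q : tensor) := tsum (seq_mul (repr p) (repr q)).

Lemma tensor_oppE s : tensor_opp (tsum s) = tsum (seq_opp s).
Proof. by apply/eq_tsum/tc_opp/tc_repr. Qed.

Lemma tensor_addE s t : tensor_add (tsum s) (tsum t) = tsum (s ++ t).
Proof. by apply/eq_tsum/tc_cat; exact: tc_repr. Qed.

Lemma tensor_mulE s t : tensor_mul (tsum s) (tsum t) = tsum (seq_mul s t).
Proof. by apply/eq_tsum/tc_mul; exact: tc_repr. Qed.

Lemma tensor_addA : associative tensor_add.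
Proof.
move=> p q r; have [[s ->] [t ->] [u ->]] := And3 (tsumP p) (tsumP q) (tsumP r).
by rewrite !tensor_addE catA.
Qed.

Lemma tensor_addC : commutative tensor_add.
Proof.
move=> p q; have [[s ->] [t ->]] := conj (tsumP p) (tsumP q).
by rewrite !tensor_addE; apply/eq_tsum/tc_catC.
Qed.

Lemma tensor_add0 : left_id (tsum [::]) tensor_add.
Proof. by move=> p; have [s ->] := tsumP p; rewrite tensor_addE. Qed.

Lemma tensor_addN : left_inverse (tsum [::]) tensor_opp tensor_add.
Proof.
move=> p; have [s ->] := tsumP p; rewrite tensor_oppE tensor_addE.
apply/eq_tsum; elim: s => [|[a b] s IHs]; first exact: tc_refl.
apply: (@tc_trans _ ([:: (- a, b); (a, b)] ++ (seq_opp s ++ s))).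
  by apply: tc_perm; rewrite /= perm_cons -cat1s perm_catCA.
apply: (tc_trans (tc_cat (tc_refl _) IHs)); rewrite cats0.
apply: (tc_trans (tc_sym (tc_Dl _ _ _))); rewrite addNr.
exact: tc_0l.
Qed.

HB.instance Definition _ := GRing.isZmodule.Build tensor
  tensor_addA tensor_addC tensor_add0 tensor_addN.

Lemma tensor_mulA : associative tensor_mul.
Proof.
move=> p q r; have [[s ->] [t ->] [u ->]] := And3 (tsumP p) (tsumP q) (tsumP r).
by rewrite !tensor_mulE seq_mulA.
Qed.

Lemma tensor_mulC : commutative tensor_mul.
Proof.
move=> p q; have [[s ->] [t ->]] := conj (tsumP p) (tsumP q).
by rewrite !tensor_mulE; apply/eq_tsum/tc_mulC.
Qed.

Lemma tensor_mul1 : left_id (tsum [:: (1, 1)]) tensor_mul.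
Proof.
move=> p; have [s ->] := tsumP p; rewrite tensor_mulE /seq_mul /= cats0.
under eq_map do rewrite !mul1r -surjective_pairing.
by rewrite map_id.
Qed.

Lemma tensor_mulD : left_distributive tensor_mul tensor_add.
Proof.
move=> p q r; have [[s ->] [t ->] [u ->]] := And3 (tsumP p) (tsumP q) (tsumP r).
by rewrite !(tensor_addE, tensor_mulE) seq_mulDl.
Qed.

HB.instance Definition _ := GRing.Zmodule_isComPzRing.Build tensor
  tensor_mulA tensor_mulC tensor_mul1 tensor_mulD.

Definition tensor_inl (a : A) : tensor := tsum [:: (a, 1)].
Definition tensor_inr (b : B) : tensor := tsum [:: (1, b)].

Lemma tensor_inl_is_zmod_morphism : zmod_morphism tensor_inl.
Proof.
move=> a a'; apply/esym.
rewrite [LHS](congr1 (tensor_add _) (tensor_oppE _)) tensor_addE.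
exact/eq_tsum/tc_sym/tc_Dl.
Qed.

Lemma tensor_inl_is_monoid_morphism : monoid_morphism tensor_inl.
Proof.
split=> // a a'; apply/esym; rewrite [LHS]tensor_mulE.
by rewrite /seq_mul /= mulr1.
Qed.

Lemma tensor_inr_is_zmod_morphism : zmod_morphism tensor_inr.
Proof.
move=> b b'; apply/esym.
rewrite [LHS](congr1 (tensor_add _) (tensor_oppE _)) tensor_addE.
apply/eq_tsum; apply: (tc_trans _ (tc_sym (tc_Dr _ _ _))).
apply: (@tc_cat [:: (1, b)] [:: (1, b)] [:: (-1, b')] [:: (1, - b')]).
  exact: tc_refl.
by rewrite -[X in (X, b')]scaleN1r -[X in (1, X)]scaleN1r; exact: tc_Z.
Qed.

Lemma tensor_inr_is_monoid_morphism : monoid_morphism tensor_inr.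
Proof.
split=> // b b'; apply/esym; rewrite [LHS]tensor_mulE.
by rewrite /seq_mul /= mulr1.
Qed.

HB.instance Definition _ :=
  GRing.isZmodMorphism.Build A tensor tensor_inl tensor_inl_is_zmod_morphism.
HB.instance Definition _ :=
  GRing.isMonoidMorphism.Build A tensor tensor_inl tensor_inl_is_monoid_morphism.
HB.instance Definition _ :=
  GRing.isZmodMorphism.Build B tensor tensor_inr tensor_inr_is_zmod_morphism.
HB.instance Definition _ :=
  GRing.isMonoidMorphism.Build B tensor tensor_inr tensor_inr_is_monoid_morphism.

End Tensor.

Arguments tensor {k} A B.
Arguments tensor_inl {k} A B a.
Arguments tensor_inr {k} A B b.

(* Main.v *)
From HB Require Import structures.
Require Import Defs.
From mathcomp Require Import all_boot all_algebra all_classical ring.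

Set Implicit Arguments.
Unset Strict Implicit.
Unset Printing Implicit Defensive.

Import GRing.Theory.

Local Open Scope ring_scope.
Local Open Scope classical_set_scope.

(** The symbolic powers of [I] and of [J] are decreasing filtrations by ideals.
    For such filtrations [F] and [G], linear algebra over [k] shows that
    [sum_(i + j = n) F_i (x) G_j] is the intersection, over [i + j = n + 1] with
    [i, j > 0], of the ideals [F_i R + G_j R], and that these sums commute with
    intersections in either argument.  So one inclusion reduces to: for [p] and
    [q] minimal over [I] and [J], if [f] is in the [n]-th symbolic power of
    [I + J], then [f] is in [N = V R + W R], where [V] and [W] are the
    contractions of [I^i A_p] and [J^j B_q].

    If not, some colon ideal [Q = (N : g)], [g] a multiple of [f] outside [N], is
    prime, and it contracts to [p] and [q].  Once [Q] is known to be minimal over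
    [I + J], the hypothesis on [f] gives a contradiction.  Minimality is proved by
    counting.  Suppose that [P] is a prime contained in [Q] with the same
    contractions and that [s = sum_l a_l (x) b_l] is in [Q] but not in [P].  Let
    [b(m)] be the rank over [B / q], modulo [Q], of the monomials in the [a_l] with
    exponents at most [m].  Multiplying by powers of [s], which vanishes modulo [Q]
    but not modulo [P], gives [b(0) + ... + b(m)] independent elements modulo [P],
    so this sum is at most the [k]-dimension modulo [p] of the span of the
    monomials; and since [Q] is the annihilator of [g], which has [c] terms, that
    dimension is at most [c b(m)].  Hence [b] outgrows every polynomial, although
    [b(m)] is at most the number of monomials.

    The other inclusion uses that primes minimal over [I + J] contract to primes
    minimal over [I] and [J] (going down). *)

(** * Ideals and Noetherian rings *)

Section Ideals.
Variable S : comPzRingType.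
Implicit Types (Q X Y : set S) (x y : S).

Lemma ideal0 Q : is_ideal Q -> Q 0. Proof. by case. Qed.

Lemma idealD Q x y : is_ideal Q -> Q x -> Q y -> Q (x + y).
Proof. by case=> _ + _; apply. Qed.

Lemma idealM Q x y : is_ideal Q -> Q y -> Q (x * y).
Proof. by case=> _ _; apply. Qed.

Lemma idealMr Q x y : is_ideal Q -> Q x -> Q (x * y).
Proof. by rewrite mulrC; apply: idealM. Qed.

Lemma idealB Q x y : is_ideal Q -> Q x -> Q y -> Q (x - y).
Proof. by move=> iQ Qx Qy; apply: idealD => //; rewrite -mulN1r; apply: idealM. Qed.

Lemma idealDr Q x y : is_ideal Q -> Q y -> Q (x + y) -> Q x.
Proof. by move=> iQ Qy Qxy; rewrite -(addrK y x); apply: idealB. Qed.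

Lemma idealDl Q x y : is_ideal Q -> Q x -> Q (x + y) -> Q y.
Proof. by rewrite addrC; apply: idealDr. Qed.

Lemma ideal_sum Q (T : Type) (r : seq T) (P : pred T) (F : T -> S) :
  is_ideal Q -> (forall i, P i -> Q (F i)) -> Q (\sum_(i <- r | P i) F i).
Proof. by move=> iQ QF; apply: big_ind => // *; [exact: ideal0|exact: idealD]. Qed.

Lemma setT_ideal : is_ideal [set: S]. Proof. by []. Qed.

Lemma bigcap_ideal (T : Type) (D : set T) (F : T -> set S) :
  (forall i, D i -> is_ideal (F i)) -> is_ideal (\bigcap_(i in D) F i).
Proof.
move=> iF; split=> [i Di|x y Fx Fy i Di|a x Fx i Di].
- exact: ideal0 (iF _ Di).
- by apply: idealD; [exact: iF|exact: Fx|exact: Fy].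
- by apply: idealM; [exact: iF|exact: Fx].
Qed.

Lemma colon_ideal Q y : is_ideal Q -> is_ideal [set x | Q (x * y)].
Proof.
move=> iQ; split=> [|u v|a u] /=; rewrite ?mul0r ?mulrDl -?mulrA.
- exact: ideal0.
- exact: idealD.
- exact: idealM.
Qed.

Lemma ideal_gen_ideal X : is_ideal (ideal_gen X).
Proof. by apply: bigcap_ideal => Q []. Qed.

Lemma ideal_gen_sub X : X `<=` ideal_gen X.
Proof. exact: sub_gen_smallest. Qed.

Lemma ideal_gen_min X Q : is_ideal Q -> X `<=` Q -> ideal_gen X `<=` Q.
Proof. exact: smallest_sub. Qed.

Lemma ideal_add_ideal Q Q' : is_ideal Q -> is_ideal Q' -> is_ideal (ideal_add Q Q').
Proof.
move=> iQ iQ'; split=> [|_ _ [x Qx [x' Qx' <-]] [y Qy [y' Qy' <-]]|a _ [x Qx [x' Qx' <-]]].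
- by exists 0; [exact: ideal0|exists 0; [exact: ideal0|rewrite addr0]].
- exists (x + y); first exact: idealD.
  by exists (x' + y'); [exact: idealD|rewrite addrACA].
- exists (a * x); first exact: idealM.
  by exists (a * x'); [exact: idealM|rewrite mulrDr].
Qed.

Lemma ideal_add_subl Q Q' : is_ideal Q' -> Q `<=` ideal_add Q Q'.
Proof. by move=> iQ' x Qx; exists x => //; exists 0; [exact: ideal0|rewrite addr0]. Qed.

Lemma ideal_add_subr Q Q' : is_ideal Q -> Q' `<=` ideal_add Q Q'.
Proof. by move=> iQ x Qx; exists 0; [exact: ideal0|exists x => //; rewrite add0r]. Qed.

Lemma ideal_add_min Q Q' X :
  is_ideal X -> Q `<=` X -> Q' `<=` X -> ideal_add Q Q' `<=` X.
Proof. by move=> iX QX Q'X _ [x /QX Xx [y /Q'X Xy <-]]; exact: idealD. Qed.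

Lemma ideal_add_mono X X' Y Y' :
  X `<=` X' -> Y `<=` Y' -> ideal_add X Y `<=` ideal_add X' Y'.
Proof. by move=> XX' YY' _ [x /XX' ? [y /YY' ? <-]]; exists x => //; exists y. Qed.

Lemma ideal_mulP Q Q' x y : Q x -> Q' y -> ideal_mul Q Q' (x * y).
Proof. by move=> Qx Qy; apply: ideal_gen_sub; exists x => //; exists y. Qed.

Lemma ideal_mul_ideal Q Q' : is_ideal (ideal_mul Q Q').
Proof. exact: ideal_gen_ideal. Qed.

Lemma ideal_mul_min Q Q' X : is_ideal X ->
  (forall x y, Q x -> Q' y -> X (x * y)) -> ideal_mul Q Q' `<=` X.
Proof. by move=> iX QX; apply: ideal_gen_min => // _ [x Qx [y Qy <-]]; exact: QX. Qed.

Lemma ideal_exp_ideal Q n : is_ideal (ideal_exp Q n).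
Proof. by case: n => [|n]; [exact: setT_ideal|exact: ideal_mul_ideal]. Qed.

Lemma ideal_exp_mono X Y n : X `<=` Y -> ideal_exp X n `<=` ideal_exp Y n.
Proof.
move=> XY; elim: n => [//|n IHn].
apply: ideal_mul_min; first exact: ideal_exp_ideal.
by move=> x y /XY ? /IHn ?; exact: ideal_mulP.
Qed.

Lemma ideal_expS_sub Q n : ideal_exp Q n.+1 `<=` ideal_exp Q n.
Proof.
apply: ideal_mul_min => [|x y _ Qy]; first exact: ideal_exp_ideal.
by apply: idealM Qy; exact: ideal_exp_ideal.
Qed.

Lemma expr_ideal_exp Q x n : Q x -> ideal_exp Q n (x ^+ n).
Proof. by move=> Qx; elim: n => [//|n IHn]; rewrite exprS; exact: ideal_mulP. Qed.

Lemma ideal_exp_mul Q m n x y :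
  ideal_exp Q m x -> ideal_exp Q n y -> ideal_exp Q (m + n) (x * y).
Proof.
move=> + Qy; elim: m x => [|m IHm] x.
  by move=> _; apply: idealM Qy; exact: ideal_exp_ideal.
suff : ideal_exp Q m.+1 `<=` [set x | ideal_exp Q (m.+1 + n) (x * y)] by apply.
apply: ideal_mul_min => [|u v Qu Qv /=].
  exact/colon_ideal/ideal_exp_ideal.
by rewrite -mulrA; apply: ideal_mulP => //; exact: IHm.
Qed.

(* Each term [X^a Y^b], [a + b = n], of the binomial expansion has [a >= i] or
   [b >= j]. *)
Lemma ideal_add_exp_sub X Y n i j : (i + j <= n.+1)%N ->
  ideal_exp (ideal_add X Y) n `<=` ideal_add (ideal_exp X i) (ideal_exp Y j).
Proof.
have iXY i' j' : is_ideal (ideal_add (ideal_exp X i') (ideal_exp Y j')).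
  by apply: ideal_add_ideal; exact: ideal_exp_ideal.
have full i' j' : i' = 0%N \/ j' = 0%N ->
    setT `<=` ideal_add (ideal_exp X i') (ideal_exp Y j').
  case=> ->; first by apply: ideal_add_subl; exact: ideal_exp_ideal.
  by apply: ideal_add_subr; exact: ideal_exp_ideal.
elim: n i j => [|n IHn] [|i] [|j] ij x Zx;
  try by apply: full => //; tauto.
  by move: ij; rewrite addSn addnS.
move: x Zx; apply: ideal_mul_min => // _ z [x Xx [y Yy <-]] Zz.
rewrite mulrDl; apply: idealD => //.
- have [|u Xu [v Yv <-]] := IHn i j.+1 _ z Zz; first by rewrite -ltnS -addSn.
  rewrite mulrDr; apply: idealD => //.
    by apply: (ideal_add_subl (ideal_exp_ideal _ _)); exact: ideal_mulP.
  apply: (ideal_add_subr (ideal_exp_ideal _ _)).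
  exact: (idealM _ (ideal_exp_ideal _ _)).
- have [|u Xu [v Yv <-]] := IHn i.+1 j _ z Zz; first by rewrite -ltnS -addnS.
  rewrite mulrDr; apply: idealD => //.
    apply: (ideal_add_subl (ideal_exp_ideal _ _)).
    exact: (idealM _ (ideal_exp_ideal _ _)).
  by apply: (ideal_add_subr (ideal_exp_ideal _ _)); exact: ideal_mulP.
Qed.

Lemma sum_ideal_min n (F : 'I_n -> set S) X : is_ideal X ->
  (forall i, F i `<=` X) -> \big[@ideal_add S/[set 0]]_(i < n) F i `<=` X.
Proof.
move=> iX; elim: n F => [|n IHn] F FX.
  by rewrite big_ord0 => _ ->; exact: ideal0.
by rewrite big_ord_recl; apply: ideal_add_min => //; apply: IHn.
Qed.

Lemma sum_ideal_ideal n (F : 'I_n -> set S) : (forall i, is_ideal (F i)) ->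
  is_ideal (\big[@ideal_add S/[set 0]]_(i < n) F i).
Proof.
elim: n F => [|n IHn] F iF.
  rewrite big_ord0; split=> [//|_ _ -> ->|a _ ->]; first by rewrite /= addr0.
  by rewrite /= mulr0.
by rewrite big_ord_recl; apply: ideal_add_ideal => //; exact: IHn.
Qed.

Lemma sum_ideal_sub n (F : 'I_n -> set S) i : (forall i, is_ideal (F i)) ->
  F i `<=` \big[@ideal_add S/[set 0]]_(i < n) F i.
Proof.
elim: n F i => [|n IHn] F i iF; first by case: i.
rewrite big_ord_recl; have [j ->|->] := unliftP ord0 i.
  apply: (subset_trans (IHn (fun j => F (lift ord0 j)) j _)) => //.
  exact: ideal_add_subr.
by apply: ideal_add_subl; exact: sum_ideal_ideal.
Qed.

End Ideals.

(** * Extension of ideals along a ring homomorphism *)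

Section Extension.
Variables (S T : comPzRingType) (f : {rmorphism S -> T}).
Implicit Types (Q : set S).

Lemma ideal_ext_ideal Q : is_ideal (ideal_ext f Q).
Proof. exact: ideal_gen_ideal. Qed.

Lemma ideal_ext_sub Q x : Q x -> ideal_ext f Q (f x).
Proof. by move=> Qx; apply: ideal_gen_sub; exists x. Qed.

Lemma ideal_ext_min Q (X : set T) :
  is_ideal X -> (forall x, Q x -> X (f x)) -> ideal_ext f Q `<=` X.
Proof. by move=> iX QX; apply: ideal_gen_min => // _ [x Qx <-]; exact: QX. Qed.

Lemma ideal_ext_mono Q Q' : Q `<=` Q' -> ideal_ext f Q `<=` ideal_ext f Q'.
Proof.
move=> QQ'; apply: ideal_ext_min; first exact: ideal_ext_ideal.
by move=> x /QQ'; exact: ideal_ext_sub.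
Qed.

Lemma preimage_ideal (X : set T) : is_ideal X -> is_ideal (f @^-1` X).
Proof.
move=> iX; split=> [|x y|a x] /=; rewrite ?rmorph0 ?rmorphD ?rmorphM.
- exact: ideal0.
- exact: idealD.
- exact: idealM.
Qed.

Lemma ideal_exp_ext Q n x : ideal_exp Q n x -> ideal_exp (ideal_ext f Q) n (f x).
Proof.
elim: n x => [//|n IHn] x.
suff : ideal_exp Q n.+1 `<=` f @^-1` (ideal_exp (ideal_ext f Q) n.+1) by apply.
apply: ideal_mul_min => [|u v Qu Qv /=].
  by apply: preimage_ideal; exact: ideal_exp_ideal.
by rewrite rmorphM; apply: ideal_mulP; [exact: ideal_ext_sub|exact: IHn].
Qed.

Lemma ideal_ext_exp Q n : ideal_exp (ideal_ext f Q) n `<=` ideal_ext f (ideal_exp Q n).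
Proof.
elim: n => [x _|n IHn].
  rewrite -(mulr1 x) -(rmorph1 f); apply: (idealM _ (ideal_ext_ideal _)).
  exact: ideal_ext_sub.
(* For a fixed cofactor [z] the condition on [y] defines an ideal, so each factor of a product can
   be reduced in turn to a generator. *)
have iE z : is_ideal [set y | ideal_ext f (ideal_exp Q n.+1) (y * z)].
  exact/colon_ideal/ideal_ext_ideal.
apply: ideal_mul_min => [|x y Qx /IHn]; first exact: ideal_ext_ideal.
rewrite mulrC; move: y; apply: ideal_ext_min => [|v Qv]; first exact: iE.
rewrite /= mulrC; move: x Qx; apply: ideal_ext_min => [|u Qu]; first exact: iE.
by rewrite /= -rmorphM; apply: ideal_ext_sub; exact: ideal_mulP.
Qed.

End Extension.

(** * Contractions of localized ideals, and symbolic powers expressed through them *)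

Section Primes.
Variable S : comPzRingType.
Implicit Types (P : prime_ideal S) (Q X : set S).

Lemma primeX P x n : prime_set P (x ^+ n)%R -> prime_set P x.
Proof.
elim: n => [/prime_not1//|n IHn]; rewrite exprS => /prime_mul[]//.
Qed.

Lemma prime_mulN P x y : ~ prime_set P x -> ~ prime_set P y -> ~ prime_set P (x * y)%R.
Proof. by move=> Px Py /prime_mul[]. Qed.

(* The contraction to [S] of [Q S_P]. *)
Definition saturation P Q : set S := [set x | exists2 s, ~ prime_set P s & Q (s * x)].

Lemma saturation_ideal P Q : is_ideal Q -> is_ideal (saturation P Q).
Proof.
move=> iQ; split=> [|x y [s Ps Qx] [t Pt Qy]|a x [s Ps Qx]].
- by exists 1; [exact: prime_not1|rewrite mulr0; exact: ideal0].
- exists (s * t); first exact: prime_mulN.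
  have -> : s * t * (x + y) = t * (s * x) + s * (t * y) by ring.
  by apply: idealD => //; exact: idealM.
- by exists s => //; rewrite mulrCA; exact: idealM.
Qed.

Lemma saturation_sub P Q : Q `<=` saturation P Q.
Proof. by move=> x Qx; exists 1; [exact: prime_not1|rewrite mul1r]. Qed.

Lemma saturation_regular P Q s x :
  ~ prime_set P s -> saturation P Q (s * x) -> saturation P Q x.
Proof.
move=> Ps [t Pt Qx]; exists (t * s); first exact: prime_mulN.
by rewrite -mulrA.
Qed.

(** The fractions with numerator in [Q] already form an ideal of the local ring, and equality of
    [x / 1] with such a fraction supplies the multiplier outside [P]. Conversely [x] is [1 / s]
    times the image of [s * x]. *)
Lemma loc_mapP P Q x : is_ideal Q ->
  ideal_ext (@loc_map S P) Q (loc_map P x) <-> saturation P Q x.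
Proof.
move=> iQ; split=> [|[s Ps Qsx]].
- pose X := [set z | exists2 a, Q a & exists s, z = mkfrac a s :> localization P].
  have : ideal_ext (@loc_map S P) Q `<=` X.
    apply: ideal_ext_min => [|y Qy]; last by exists y => //; exists (denom1 P).
    split.
    - by exists 0; [exact: ideal0|exists (denom1 P)].
    - move=> _ _ [a Qa [s ->]] [b Qb [t ->]].
      exists (a * dval t + b * dval s); last first.
        by exists (denomM s t); exact: loc_addE.
      by apply: idealD => //; exact: idealMr.
    - move=> z _ [a Qa [s ->]]; have [b [t ->]] := mkfracP z.
      exists (b * a); first exact: idealM.
      by exists (denomM t s); exact: loc_mulE.
  move=> /[apply] -[a Qa [s /eq_mkfrac[u]]]; rewrite mulr1 => e.
  exists (dval u * dval s).
    have := dvalP (denomM u s); by rewrite notin_setE.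
  by rewrite -mulrA (mulrC (dval s)) e; exact: idealM.
- have Ps' : s \notin (P : set S) by rewrite notin_setE.
  have -> : loc_map P x = mkfrac 1 (Denom Ps') * loc_map P (s * x).
    rewrite [RHS]loc_mulE; apply/eq_mkfrac; exists (denom1 P).
    by rewrite !denomE /=; ring.
  by apply: (idealM _ (ideal_ext_ideal _ _)); exact: ideal_ext_sub.
Qed.

Lemma symbolic_powerE Q n : (0 < n)%N -> symbolic_power Q n =
  \bigcap_(P in minimal_primes Q) saturation P (ideal_exp Q n).
Proof.
case: n => // n _; apply/seteqP; split=> x Qx P minP; have := Qx P minP;
  by move/loc_mapP; apply; exact: ideal_exp_ideal.
Qed.

Lemma symbolic_power_ideal Q n : is_ideal (symbolic_power Q n).
Proof.
case: n => [|n]; first exact: setT_ideal.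
rewrite symbolic_powerE//; apply: bigcap_ideal => P _.
by apply: saturation_ideal; exact: ideal_exp_ideal.
Qed.

Lemma symbolic_powerS_sub Q n : symbolic_power Q n.+1 `<=` symbolic_power Q n.
Proof.
case: n => [//|n]; rewrite !symbolic_powerE// => x Qx P /Qx[s Ps Qsx].
by exists s => //; exact: ideal_expS_sub.
Qed.

Definition contraction (T : comPzRingType) (f : {rmorphism T -> S}) P : prime_ideal T.
Proof.
apply: (@PrimeIdeal _ (f @^-1` P)).
- exact/preimage_ideal/prime_is_ideal.
- by rewrite /= rmorph1; exact: prime_not1.
- by move=> x y /=; rewrite rmorphM; exact: prime_mul.
Defined.

End Primes.

(** * Maximal elements, primes avoiding a multiplicative set, associated primes *)

Section Noetherian.
Variable S : comPzRingType.
Hypothesis noethS : noetherian S.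
Implicit Types (P : prime_ideal S) (Q X : set S).

Lemma noetherian_max (F : set (set S)) : F `<=` @is_ideal S -> F !=set0 ->
  exists2 Q, F Q & forall Q', F Q' -> Q `<=` Q' -> Q' `<=` Q.
Proof.
move=> FI [Q0 FQ0].
(* Adjoining [set0] bounds the empty chain; it is not maximal, since [Q0] contains 0. The union of
   any other chain is finitely generated, hence equal to a member of the chain. *)
have [] := @Zorn_bigcup S [set Q | Q = set0 \/ F Q].
  move=> C CF Ctot.
  have [allz|/existsNP[Q1 /not_implyP[CQ1 Q1n0]]] := pselect (forall X, C X -> X = set0).
    by left; rewrite bigcup0.
  have FC X x : C X -> X x -> F X by move=> /CF[->|].
  pose D := [set X | C X /\ F X].
  have tot X Y : D X -> D Y -> X `<=` Y \/ Y `<=` X by move=> [+ _] [+ _]; exact: Ctot.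
  have ID X : D X -> is_ideal X by case=> _ /FI.
  have DQ1 : D Q1 by split=> //; have [] := CF _ CQ1.
  have uE : \bigcup_(X in C) X = \bigcup_(X in D) X.
    apply/seteqP; split=> x [X CX Xx]; last by exists X => //; case: CX.
    by exists X => //; split=> //; exact: FC Xx.
  have iD : is_ideal (\bigcup_(X in D) X).
    split=> [|x y [X DX Xx] [Y DY Yy]|a x [X DX Xx]].
    - by exists Q1 => //; exact: ideal0 (ID _ DQ1).
    - have [XY|YX] := tot _ _ DX DY.
        by exists Y => //; apply: (idealD (ID _ DY)) => //; exact: XY.
      by exists X => //; apply: (idealD (ID _ DX)) => //; exact: YX.
    - by exists X => //; exact: (idealM _ (ID _ DX)).
  have [s sE] := noethS iD.
  have [X DX sX] : exists2 X, D X & forall x, x \in s -> X x.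
    have : forall x, x \in s -> (\bigcup_(X in D) X) x.
      by move=> x xs; rewrite sE; apply: ideal_gen_sub.
    elim: s {sE} => [_|x s IHs su]; first by exists Q1.
    have [y ys|X DX sX] := IHs; first by apply: su; rewrite inE ys orbT.
    have [Y DY Yx] := su x (mem_head _ _).
    have [XY|YX] := tot _ _ DX DY.
      by exists Y => // y; rewrite inE => /predU1P[->//|/sX/XY].
    by exists X => // y; rewrite inE => /predU1P[->|/sX//]; exact: YX.
  right; rewrite uE; suff -> : \bigcup_(X in D) X = X by case: DX.
  apply/seteqP; split=> [|x Xx]; last by exists X.
  by rewrite sE; apply: ideal_gen_min => //; exact: ID.
move=> Q [[->|FQ] Qmax].
  exfalso; apply: (Qmax Q0); last by right.
  by split=> // /(_ 0 (ideal0 (FI _ FQ0))).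
exists Q => // Q' FQ' QQ'; apply: contrapT => nQ'Q.
by apply: (Qmax Q'); [split|right].
Qed.

(** An ideal [M] maximal among those containing [Q] and missing [X] is prime: if [x] and [y] are
    outside [M], then [M + (x)] and [M + (y)] both meet [X], and the product of two such elements
    would lie in [M] if [x * y] did. *)
Lemma prime_avoiding Q X : is_ideal Q -> X 1 ->
  (forall x y, X x -> X y -> X (x * y)) -> (forall x, X x -> ~ Q x) ->
  exists P : prime_ideal S, Q `<=` P /\ forall x, X x -> ~ prime_set P x.
Proof.
move=> iQ X1 XM QX.
have [||M [iM [QM MX]] Mmax] := @noetherian_max
    [set M | is_ideal M /\ Q `<=` M /\ forall x, X x -> ~ M x].
  - by move=> M [].
  - by exists Q; split; [|split].
have ext x : ~ M x -> exists2 u, X u & exists2 m, M m & exists a, u = m + a * x.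
  move=> Mx; apply: contrapT => noX.
  pose M' := [set z | exists2 m, M m & exists a, z = m + a * x].
  have MM' : M `<=` M' by move=> m Mm; exists m => //; exists 0; rewrite mul0r addr0.
  apply: Mx; apply: (Mmax M') => //; last first.
    by exists 0; [exact: ideal0|exists 1; rewrite mul1r add0r].
  split; last by split=> [|u Xu [m Mm [a uE]]]; [exact: subset_trans MM'|apply: noX;
    exists u => //; exists m => //; exists a].
  split=> [|_ _ [m Mm [a ->]] [m' Mm' [a' ->]]|c _ [m Mm [a ->]]].
  - exact: MM' (ideal0 iM).
  - exists (m + m'); first exact: idealD.
    by exists (a + a'); ring.
  - exists (c * m); first exact: idealM.
    by exists (c * a); ring.
have M1 : ~ M 1 by exact: MX.
have Mprime x y : M (x * y) -> M x \/ M y.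
  move=> Mxy; apply: contrapT => /not_orP[/ext[u Xu [m Mm [a uE]]]].
  move=> /ext[v Xv [m' Mm' [a' vE]]]; apply: (MX (u * v)); first exact: XM.
  rewrite uE vE.
  have -> : (m + a * x) * (m' + a' * y) =
    (m' + a' * y) * m + (a * x) * m' + (a * a') * (x * y) by ring.
  by apply: idealD => //; [apply: idealD => //|]; exact: idealM.
by exists (PrimeIdeal iM M1 Mprime).
Qed.

(** After localization at [P], the radical of [Q] is the maximal ideal. Otherwise a prime over [Q]
    avoids all [s * x ^+ n] with [s] outside [P]; it lies in [P] and omits [x], against
    minimality. *)
Lemma minimal_prime_radical Q P x : is_ideal Q -> minimal_primes Q P -> prime_set P x ->
  exists2 s, ~ prime_set P s & exists n, Q (s * x ^+ n).
Proof.
move=> iQ [QP Pmin] Px; apply: contrapT => noQ.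
pose X := [set z | exists2 s, ~ prime_set P s & exists n, z = s * x ^+ n].
have [|||P' [QP' P'X]] := @prime_avoiding Q X iQ.
- by exists 1; [exact: prime_not1|exists 0%N; rewrite expr0 mulr1].
- move=> _ _ [s Ps [n ->]] [t Pt [m ->]]; exists (s * t); first exact: prime_mulN.
  by exists (n + m)%N; rewrite exprD mulrACA.
- by move=> _ [s Ps [n ->]] Qs; apply: noQ; exists s => //; exists n.
have P'P : P' `<=` P.
  move=> y P'y; apply: contrapT => Py; apply: (P'X y) => //.
  by exists y => //; exists 0%N; rewrite expr0 mulr1.
apply: (P'X x); last by rewrite (Pmin P').
by exists 1; [exact: prime_not1|exists 1%N; rewrite mul1r expr1].
Qed.

(** Choose a multiple [g] of [f] outside [N] with [(N : g)] maximal. If [y * g] is outside [N], then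
    [(N : g)] and [(N : y * g)] coincide by maximality, which is primality. *)
Lemma colon_prime N f : is_ideal N -> ~ N f ->
  exists2 g, ~ N g & exists2 r, g = r * f &
  exists Q : prime_ideal S, forall x, prime_set Q x <-> N (x * g).
Proof.
move=> iN Nf.
pose col g : set S := [set x | N (x * g)].
have icol g : is_ideal (col g) by exact: colon_ideal.
have [||C [g [Ng [r gE]] ->] Cmax] := @noetherian_max
    [set C | exists2 g, ~ N g /\ (exists r, g = r * f) & C = col g].
- by move=> _ [g _ ->].
- by exists (col f), f => //; split=> //; exists 1; rewrite mul1r.
have c1 : ~ col g 1 by rewrite /col /= mul1r.
have cprime x y : col g (x * y) -> col g x \/ col g y.
  move=> gxy; have [gy|ngy] := pselect (col g y); first by right.
  left; apply: (Cmax (col (y * g))).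
  - by exists (y * g) => //; split=> //; exists (y * r); rewrite gE mulrA.
  - by move=> z; rewrite /col /= mulrCA; exact: idealM.
  - by rewrite /col /= mulrA.
by exists g => //; exists r => //; exists (PrimeIdeal (icol g) c1 cprime).
Qed.

End Noetherian.

(** * Ideals of tensor products over a field *)

Section Functional.
Variables (k : fieldType) (V : lmodType k).

Definition is_subspace (W : set V) : Prop :=
  [/\ W 0, forall x y, W x -> W y -> W (x + y) & forall c x, W x -> W (c *: x)].

(** A subspace [H] maximal among those containing [W] and missing [b] is a hyperplane complementary
    to the line of [b]; [psi] is the coordinate along [b]. *)
Lemma separating_functional (W : set V) (b : V) : is_subspace W -> ~ W b ->
  exists2 psi : {scalar V}, (forall w, W w -> psi w = 0) & psi b = 1.
Proof.
move=> sW Wb.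
pose good X := [/\ is_subspace X, W `<=` X & ~ X b].
have [C CF Ctot|] := @Zorn_bigcup V [set X | X = set0 \/ good X].
  have [[x0 [X0 CX0 X0x0]]|noC] := pselect ((\bigcup_(X in C) X) !=set0); last first.
    by left; apply/seteqP; split=> // x Cx; apply: noC; exists x.
  have gC X x : C X -> X x -> good X by move=> /CF[->|].
  have [[X00 _ _] WX0 _] := gC _ _ CX0 X0x0.
  right; split=> [|w Ww|[X CX Xb]]; first last.
  - by case: (gC _ _ CX Xb).
  - by exists X0 => //; exact: WX0.
  split=> [|x y [X CX Xx] [Y CY Yy]|c x [X CX Xx]].
  - by exists X0.
  - have [XY|YX] := Ctot _ _ CX CY.
      by exists Y => //; have [[_ YD _] _ _] := gC _ _ CY Yy; apply: YD => //; exact: XY.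
    by exists X => //; have [[_ XD _] _ _] := gC _ _ CX Xx; apply: XD => //; exact: YX.
  - by exists X => //; have [[_ _ XZ] _ _] := gC _ _ CX Xx; apply: XZ.
move=> H [[->|[[H0 HD HZ] WH Hb]] Hmax].
  exfalso; apply: (Hmax W); last by right; split.
  by split=> // /(_ 0); case: sW => W0 _ _ /(_ W0).
have dec v : exists c, H (v - c *: b).
  have [Hv|Hv] := pselect (H v); first by exists 0; rewrite scale0r subr0.
  (* By maximality [H + k v] contains [b], say [b = h + c v]; here [c] is nonzero because [b] is not
     in [H], so [v] is solved for by dividing by [c]. *)
  pose H' := [set h + c *: v | h in H & c in [set: k]].
  have HH' : H `<=` H' by move=> h Hh; exists h => //; exists 0 => //; rewrite scale0r addr0.
  have [[h Hh [c _ hcb]]|H'b] := pselect (H' b).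
    have c0 : c != 0.
      by apply/eqP => c0; apply: Hb; rewrite -hcb c0 scale0r addr0.
    exists c^-1; rewrite -hcb scalerDr scalerA mulVf// scale1r opprD addrC -addrA addNr addr0.
    by rewrite -scaleNr; exact: HZ.
  exfalso; apply: (Hmax H').
    by split=> // H'H; apply/Hv/H'H; exists 0 => //; exists 1 => //; rewrite scale1r add0r.
  right; split=> //; last by exact: subset_trans HH'.
  split=> [|_ _ [h Hh [c _ <-]] [h' Hh' [c' _ <-]]|c _ [h Hh [c' _ <-]]].
  - exact: HH'.
  - exists (h + h'); first exact: HD.
    by exists (c + c') => //; rewrite scalerDl addrACA.
  - exists (c *: h); first exact: HZ.
    by exists (c * c') => //; rewrite scalerDr scalerA.
have HB x y : H x -> H y -> H (x - y) by move=> ? ?; rewrite -scaleN1r; apply: HD; last exact: HZ.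
have uniq_dec v c d : H (v - c *: b) -> H (v - d *: b) -> c = d.
  move=> Hc /HB /(_ Hc); rewrite opprB addrC addrA addrNK -scaleNr addrC -scalerDl.
  have [/eqP|cd] := eqVneq (c - d) 0; first by rewrite subr_eq0 => /eqP.
  rewrite addrC; move=> /(HZ (c - d)^-1); rewrite scalerA mulVf// scale1r.
  by [].
have [psi psiP] := choice dec.
have lin : scalar psi.
  move=> c u v; apply/(uniq_dec _ _ _ (psiP _)).
  have -> : c *: u + v - (c * psi u + psi v) *: b = c *: (u - psi u *: b) + (v - psi v *: b).
    by rewrite scalerBr scalerDl scalerA opprD addrACA.
  by apply: HD => //; exact: HZ.
pose m := GRing.isLinear.Build k V k *%R psi lin.
pose Psi : {scalar V} := HB.pack psi m.
exists Psi => [w Ww|] /=.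
  by apply: uniq_dec (psiP w) _; rewrite scale0r subr0; exact: WH.
by apply: uniq_dec (psiP b) _; rewrite scale1r subrr.
Qed.

End Functional.

(** * Membership in [V R + W R], tested by linear functionals on one factor *)

Section TensorIdeals.
Variables (k : fieldType) (A B : comAlgType k).
Local Notation R := (tensor A B).
Local Notation inl := (tensor_inl A B).
Local Notation inr := (tensor_inr A B).
Implicit Types (a : A) (b : B) (V U : set A) (W : set B) (s : seq (A * B)).

Lemma tsumD s t : tsum (s ++ t) = tsum s + tsum t :> R.
Proof. exact/esym/tensor_addE. Qed.

Lemma tsumM s t : tsum (seq_mul s t) = tsum s * tsum t :> R.
Proof. exact/esym/tensor_mulE. Qed.

Lemma tsum1 a b : tsum [:: (a, b)] = inl a * inr b :> R.
Proof. by rewrite /tensor_inl /tensor_inr -tsumM /seq_mul /= mulr1 mul1r. Qed.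

Lemma tsumE s : tsum s = \sum_(x <- s) inl x.1 * inr x.2 :> R.
Proof.
elim: s => [|[a b] s IHs]; first by rewrite big_nil.
by rewrite big_cons -cat1s tsumD IHs tsum1.
Qed.

Lemma tensorZ c a b : inl (c *: a) * inr b = inl a * inr (c *: b).
Proof. by rewrite -!tsum1; apply/eq_tsum/tc_Z. Qed.

Lemma inl_scale c : inl c%:A = inr c%:A.
Proof. by have := tensorZ c 1 1; rewrite !rmorph1 mulr1 mul1r. Qed.

Lemma ideal_subspace (C : comAlgType k) (W : set C) : is_ideal W -> is_subspace W.
Proof.
move=> iW; split=> [|x y|c x]; [exact: ideal0|exact: idealD|].
by rewrite -mulr_algl; exact: idealM.
Qed.

Section Contraction.

(** This is the map [id (x) psi] from [A (x) B] to [A], computed on a representative;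
    [contract_right_tsum] shows that every representative gives the same value. *)
Definition contract_right (psi : {scalar B}) (t : R) : A :=
  \sum_(x <- repr t) psi x.2 *: x.1.
Definition contract_left (psi : {scalar A}) (t : R) : B :=
  \sum_(x <- repr t) psi x.1 *: x.2.

Lemma contract_right_tsum psi s :
  contract_right psi (tsum s) = \sum_(x <- s) psi x.2 *: x.1.
Proof.
have tcE s1 s2 : tensor_cong s1 s2 ->
    \sum_(x <- s1) psi x.2 *: x.1 = \sum_(x <- s2) psi x.2 *: x.1.
  elim=> {s1 s2} //=.
  - by move=> ? ? ? _ -> _ ->.
  - by move=> ? ? ? ? _ E _ E'; rewrite !big_cat /= E E'.
  - by move=> s1 s2; rewrite !big_cat /= addrC.
  - by move=> b; rewrite big_seq1 big_nil scaler0.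
  - by move=> a; rewrite big_seq1 big_nil linear0 scale0r.
  - by move=> a a' b; rewrite !big_cons !big_nil !addr0 scalerDr.
  - by move=> a b b'; rewrite !big_cons !big_nil !addr0 linearD scalerDl.
  - by move=> c a b; rewrite !big_seq1 /= (linearZ_LR psi) /= scalerA mulrC.
exact: tcE (tc_repr s).
Qed.

Lemma contract_left_tsum psi s :
  contract_left psi (tsum s) = \sum_(x <- s) psi x.1 *: x.2.
Proof.
have tcE s1 s2 : tensor_cong s1 s2 ->
    \sum_(x <- s1) psi x.1 *: x.2 = \sum_(x <- s2) psi x.1 *: x.2.
  elim=> {s1 s2} //=.
  - by move=> ? ? ? _ -> _ ->.
  - by move=> ? ? ? ? _ E _ E'; rewrite !big_cat /= E E'.
  - by move=> s1 s2; rewrite !big_cat /= addrC.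
  - by move=> b; rewrite big_seq1 big_nil linear0 scale0r.
  - by move=> a; rewrite big_seq1 big_nil scaler0.
  - by move=> a a' b; rewrite !big_cons !big_nil !addr0 linearD scalerDl.
  - by move=> a b b'; rewrite !big_cons !big_nil !addr0 scalerDr.
  - by move=> c a b; rewrite !big_seq1 /= (linearZ_LR psi) /= scalerA mulrC.
exact: tcE (tc_repr s).
Qed.

Lemma contract_rightD psi t u :
  contract_right psi (t + u) = contract_right psi t + contract_right psi u.
Proof.
have [[s ->] [s' ->]] := conj (tsumP t) (tsumP u).
by rewrite -tsumD !contract_right_tsum big_cat.
Qed.

Lemma contract_right_sum psi (T : Type) (r : seq T) (F : T -> R) :
  contract_right psi (\sum_(i <- r) F i) = \sum_(i <- r) contract_right psi (F i).
Proof.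
apply: (big_morph _ (contract_rightD psi)).
by rewrite -[0]/(tsum [::]) contract_right_tsum big_nil.
Qed.

Lemma contract_right_inl psi a t :
  contract_right psi (inl a * t) = a * contract_right psi t.
Proof.
have [s ->] := tsumP t; rewrite -tsumM /seq_mul /= cats0 !contract_right_tsum.
rewrite big_map mulr_sumr; apply: eq_bigr => x _ /=.
by rewrite mul1r scalerAr.
Qed.

Lemma contract_left_inr psi b t :
  contract_left psi (inr b * t) = b * contract_left psi t.
Proof.
have [s ->] := tsumP t; rewrite -tsumM /seq_mul /= cats0 !contract_left_tsum.
rewrite big_map mulr_sumr; apply: eq_bigr => x _ /=.
by rewrite mul1r scalerAr.
Qed.

Lemma contract_right_left (chi : {scalar B}) (psi : {scalar A}) t :
  psi (contract_right chi t) = chi (contract_left psi t).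
Proof.
have [s ->] := tsumP t; rewrite contract_right_tsum contract_left_tsum !linear_sum.
by apply: eq_bigr => x _; rewrite !linearZ /= mulrC.
Qed.

End Contraction.

Lemma ext_inlP V t : is_ideal V -> ideal_ext inl V t <->
  exists2 s, t = tsum s & forall x, x \in s -> V x.1.
Proof.
move=> iV; split=> [|[s -> sV]]; last first.
  rewrite tsumE big_seq; apply: ideal_sum; first exact: ideal_ext_ideal.
  by move=> x /sV Vx; apply: (idealMr _ (ideal_ext_ideal _ _)); exact: ideal_ext_sub.
pose X := [set t | exists2 s, t = tsum s :> R & forall x, x \in s -> V x.1].
suff : ideal_ext inl V `<=` X by apply.
apply: ideal_ext_min => [|a Va].
  split=> [|_ _ [s -> sV] [s' -> s'V]|r _ [s -> sV]].
  - by exists [::].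
  - exists (s ++ s'); first by rewrite tsumD.
    by move=> x; rewrite mem_cat => /orP[/sV|/s'V].
  - have [u ->] := tsumP r; exists (seq_mul u s); first by rewrite tsumM.
    by move=> x /allpairsP[[y z] [_ /sV Vz ->]]; exact: idealM.
by exists [:: (a, 1)] => // x; rewrite inE => /eqP ->.
Qed.

Lemma ext_inrP W t : is_ideal W -> ideal_ext inr W t <->
  exists2 s, t = tsum s & forall x, x \in s -> W x.2.
Proof.
move=> iW; split=> [|[s -> sW]]; last first.
  rewrite tsumE big_seq; apply: ideal_sum; first exact: ideal_ext_ideal.
  by move=> x /sW Wx; apply: (idealM _ (ideal_ext_ideal _ _)); exact: ideal_ext_sub.
pose X := [set t | exists2 s, t = tsum s :> R & forall x, x \in s -> W x.2].
suff : ideal_ext inr W `<=` X by apply.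
apply: ideal_ext_min => [|b Wb].
  split=> [|_ _ [s -> sW] [s' -> s'W]|r _ [s -> sW]].
  - by exists [::].
  - exists (s ++ s'); first by rewrite tsumD.
    by move=> x; rewrite mem_cat => /orP[/sW|/s'W].
  - have [u ->] := tsumP r; exists (seq_mul u s); first by rewrite tsumM.
    by move=> x /allpairsP[[y z] [_ /sW Wz ->]]; exact: idealM.
by exists [:: (1, b)] => // x; rewrite inE => /eqP ->.
Qed.

(** For ideals [V] and [W], this is the kernel of [A (x) B -> A / V (x) B / W]. *)
Definition ext_sum V W : set R := ideal_add (ideal_ext inl V) (ideal_ext inr W).

Lemma ext_sum_ideal V W : is_ideal (ext_sum V W).
Proof. by apply: ideal_add_ideal; exact: ideal_ext_ideal. Qed.

Lemma ext_sum_subl V W : ideal_ext inl V `<=` ext_sum V W.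
Proof. by apply: ideal_add_subl; exact: ideal_ext_ideal. Qed.

Lemma ext_sum_subr V W : ideal_ext inr W `<=` ext_sum V W.
Proof. by apply: ideal_add_subr; exact: ideal_ext_ideal. Qed.

(* Induction on the length of [s]: if the second component of the first term is
   in [W] plus the span of the others, that term can be distributed over the
   others; otherwise some [psi] singles out its first component, which is then
   in [V]. *)
Lemma tsum_contract_mem U V W s : is_ideal U -> is_ideal V -> is_ideal W ->
  (forall x, x \in s -> U x.1) ->
  (forall psi : {scalar B}, (forall w, W w -> psi w = 0) ->
    V (\sum_(x <- s) psi x.2 *: x.1)) ->
  ideal_add (ideal_ext inl V) (ideal_mul (ideal_ext inl U) (ideal_ext inr W)) (tsum s).
Proof.
move=> iU iV iW.
set X := ideal_add _ _.
have iX : is_ideal X by apply: ideal_add_ideal; exact: ideal_gen_ideal.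
have [n] := ubnP (size s); elim: n s => // n IHn [|[a b] s] /=.
  by move=> _ _ _; exact: (ideal0 iX).
rewrite ltnS => sn sU sV.
have Ua : U a by apply: (sU (a, b)); rewrite mem_head.
have sU' x : x \in s -> U x.1 by move=> xs; apply: sU; rewrite inE xs orbT.
pose sp (c : nat -> k) := \sum_(i < size s) c i *: (nth 0 s i).2.
pose Y := [set y | exists2 w, W w & exists c, y = w + sp c].
have sY : is_subspace Y.
  split=> [|_ _ [w Ww [c ->]] [w' Ww' [c' ->]]|d _ [w Ww [c ->]]].
  - exists 0; first exact: ideal0.
    by exists (fun=> 0); rewrite /sp big1 ?addr0// => i _; rewrite scale0r.
  - exists (w + w'); first exact: idealD.
    exists (fun i => c i + c' i); rewrite addrACA; congr (_ + _).
    by rewrite /sp -big_split; apply: eq_bigr => i _; rewrite scalerDl.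
  - exists (d *: w); first by rewrite -mulr_algl; exact: idealM.
    exists (fun i => d * c i); rewrite scalerDr; congr (_ + _).
    by rewrite /sp scaler_sumr; apply: eq_bigr => i _; rewrite scalerA.
have WY : W `<=` Y.
  move=> w Ww; exists w => //; exists (fun=> 0).
  by rewrite /sp big1 ?addr0// => i _; rewrite scale0r.
have sumE (T : nmodType) (F : A * B -> T) :
    \sum_(x <- s) F x = \sum_(i < size s) F (nth 0 s i).
  by rewrite (big_nth 0) big_mkord.
have [[w Ww [c bE]]|Yb] := pselect (Y b).
  pose s' := mkseq (fun i => ((nth 0 s i).1 + c i *: a, (nth 0 s i).2)) (size s).
  have sumE' (T : nmodType) (F : A * B -> T) : \sum_(x <- s') F x =
      \sum_(i < size s) F ((nth 0 s i).1 + c i *: a, (nth 0 s i).2).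
    by rewrite big_map -{1}(subn0 (size s)) -/(index_iota 0 _) big_mkord.
  rewrite -cat1s tsumD tsum1.
  have -> : inl a * inr b + tsum s = inl a * inr w + tsum s'.
    rewrite bE rmorphD mulrDr -addrA; congr (_ + _); rewrite !tsumE sumE sumE'.
    rewrite /sp raddf_sum mulr_sumr -big_split; apply: eq_bigr => i _ /=.
    by rewrite -tensorZ rmorphD mulrDl addrC.
  apply: idealD => //.
    apply: (ideal_add_subr (ideal_ext_ideal _ _)).
    by apply: ideal_mulP; exact: ideal_ext_sub.
  apply: IHn; first by rewrite size_mkseq.
    move=> x /(nthP 0)[i]; rewrite size_mkseq => is_ <-; rewrite nth_mkseq//=.
    apply: idealD => //; first by apply/sU'/mem_nth.
    by rewrite -mulr_algl; exact: idealM.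
  move=> psi psiW; have := sV psi psiW; rewrite big_cons sumE sumE' /=.
  suff -> : \sum_(i < size s) psi (nth 0 s i).2 *: ((nth 0 s i).1 + c i *: a) =
    psi b *: a + \sum_(i < size s) psi (nth 0 s i).2 *: (nth 0 s i).1 by [].
  rewrite bE linearD psiW// add0r /sp linear_sum scaler_suml -big_split.
  by apply: eq_bigr => i _ /=; rewrite linearZ /= scalerDr addrC scalerA mulrC.
have [psi psiY psib] := separating_functional sY Yb.
have psis x : x \in s -> psi x.2 = 0.
  move=> xs; apply: psiY; exists 0; first exact: ideal0.
  have js : (index x s < size s)%N by rewrite index_mem.
  exists (fun j => (j == index x s)%:R); rewrite add0r /sp.
  rewrite (bigD1 (Ordinal js))//= eqxx scale1r nth_index// big1 ?addr0// => i.
  by rewrite -val_eqE /= => /negPf ->; rewrite scale0r.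
have Va : V a.
  have := sV psi (fun w Ww => psiY w (WY w Ww)).
  rewrite big_cons psib scale1r big_seq big1 ?addr0// => x /psis ->.
  by rewrite scale0r.
rewrite -cat1s tsumD tsum1; apply: idealD => //.
  apply: (ideal_add_subl (ideal_mul_ideal _ _)).
  by apply: (idealMr _ (ideal_ext_ideal _ _)); exact: ideal_ext_sub.
apply: IHn => // chi chiW; have := sV chi chiW; rewrite big_cons.
apply: idealDl => //.
by rewrite -mulr_algl; exact: idealM.
Qed.

(** A functional killing [W] removes the [W R] part and sends [V R] into [V]; the converse is
    [tsum_contract_mem] with [U] the unit ideal. Intersections and cancellations in [V] thereby pass
    to [V R + W R]. *)
Lemma ext_sum_contract_right V W t : is_ideal V -> is_ideal W -> ext_sum V W t <->
  forall psi : {scalar B}, (forall w, W w -> psi w = 0) -> V (contract_right psi t).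
Proof.
move=> iV iW; split=> [[x /(ext_inlP _ iV)[s -> sV] [y /(ext_inrP _ iW)[s' -> s'W] <-]]|].
  move=> psi psiW; rewrite contract_rightD !contract_right_tsum.
  apply: idealD => //.
    by rewrite big_seq; apply: ideal_sum => // z /sV Vz; rewrite -mulr_algl; exact: idealM.
  rewrite big_seq big1; first exact: ideal0.
  by move=> z /s'W/psiW ->; rewrite scale0r.
have [s ->] := tsumP t => sV.
have : ideal_add (ideal_ext inl V) (ideal_mul (ideal_ext inl setT) (ideal_ext inr W)) (tsum s).
  apply: tsum_contract_mem => //.
  by move=> psi /sV; rewrite contract_right_tsum.
apply: ideal_add_mono => //; apply: ideal_mul_min; first exact: ideal_ext_ideal.
by move=> x y _; exact: (idealM _ (ideal_ext_ideal _ _)).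
Qed.

(** Both one-sided criteria amount to the vanishing of all [(psi (x) chi) t] with [psi] killing [V]
    and [chi] killing [W]; separating functionals translate between them. *)
Lemma ext_sum_contract_left V W t : is_ideal V -> is_ideal W -> ext_sum V W t <->
  forall psi : {scalar A}, (forall v, V v -> psi v = 0) -> W (contract_left psi t).
Proof.
move=> iV iW; split=> [|tW].
  move=> /(ext_sum_contract_right _ iV iW) tV psi psiV; apply: contrapT => nW.
  have [chi chiW] := separating_functional (ideal_subspace iW) nW.
  rewrite -contract_right_left psiV; last exact: tV.
  by move/eqP; rewrite eq_sym oner_eq0.
apply/ext_sum_contract_right => // chi chiW; apply: contrapT => nV.
have [psi psiV] := separating_functional (ideal_subspace iV) nV.
rewrite contract_right_left chiW; last exact: tW.
by move/eqP; rewrite eq_sym oner_eq0.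
Qed.

Lemma ext_sum_bigcap_left (T : Type) (D : set T) (F : T -> set A) W t :
  (forall i, is_ideal (F i)) -> is_ideal W ->
  (forall i, D i -> ext_sum (F i) W t) -> ext_sum (\bigcap_(i in D) F i) W t.
Proof.
move=> iF iW tF; apply/ext_sum_contract_right => //; first exact: bigcap_ideal.
by move=> psi psiW i /tF/ext_sum_contract_right; apply.
Qed.

Lemma ext_sum_bigcap_right (T : Type) (D : set T) (F : T -> set B) V t :
  is_ideal V -> (forall i, is_ideal (F i)) ->
  (forall i, D i -> ext_sum V (F i) t) -> ext_sum V (\bigcap_(i in D) F i) t.
Proof.
move=> iV iF tF; apply/ext_sum_contract_left => //; first exact: bigcap_ideal.
by move=> psi psiV i /tF/ext_sum_contract_left; apply.
Qed.

(** A form of flatness: contraction is [A]-linear, so a nonzerodivisor modulo [V] remains one modulo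
    [V R + W R]. *)
Lemma ext_sum_regular_left V W a t : is_ideal V -> is_ideal W ->
  (forall x, V (a * x) -> V x) -> ext_sum V W (inl a * t) -> ext_sum V W t.
Proof.
move=> iV iW Va /ext_sum_contract_right aV; apply/ext_sum_contract_right => //.
by move=> psi psiW; apply: Va; rewrite -contract_right_inl; exact: aV.
Qed.

Lemma ext_sum_regular_right V W b t : is_ideal V -> is_ideal W ->
  (forall x, W (b * x) -> W x) -> ext_sum V W (inr b * t) -> ext_sum V W t.
Proof.
move=> iV iW Wb /ext_sum_contract_left bW; apply/ext_sum_contract_left => //.
by move=> psi psiV; apply: Wb; rewrite -contract_left_inr; exact: bW.
Qed.

(** A representative of [t] with first components in [U] keeps that property throughout the
    induction of [tsum_contract_mem], so the [W R] part acquires coefficients in [U]. *)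
Lemma ext_sum_modular U V W t : is_ideal U -> is_ideal V -> is_ideal W ->
  ideal_ext inl U t -> ext_sum V W t ->
  ideal_add (ideal_ext inl V) (ideal_mul (ideal_ext inl U) (ideal_ext inr W)) t.
Proof.
move=> iU iV iW /(ext_inlP _ iU)[s -> sU] /(ext_sum_contract_right _ iV iW) sV.
by apply: tsum_contract_mem => // psi /sV; rewrite contract_right_tsum.
Qed.

End TensorIdeals.

(** * Linear independence modulo a prime, and growth *)

(** Gaussian elimination without division over the domain [S / q]: a homogeneous system with more
    unknowns than equations has a nonzero solution. *)
Lemma prime_ideal_kernel (S : comPzRingType) (q : prime_ideal S) (n m : nat)
    (M : nat -> nat -> S) : (n < m)%N ->
  exists2 c : nat -> S, (exists2 i, (i < m)%N & ~ prime_set q (c i)) &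
    forall j, (j < n)%N -> prime_set q (\sum_(i < m) c i * M i j)%R.
Proof.
have iq := prime_is_ideal q.
elim: n m M => [|n IHn] m M nm.
  by exists (fun=> 1) => //; exists 0%N => //; exact: prime_not1.
have [[i0 i0m qi0]|noi] := pselect (exists2 i, (i < m)%N & ~ prime_set q (M i n)); last first.
  have [c [i im ci] cM] := IHn _ M (ltnW nm); exists c; first by exists i.
  move=> j; rewrite ltnS leq_eqVlt => /predU1P[->|/cM//].
  apply: ideal_sum => // i' _; apply: idealM => //; apply: contrapT => qi'.
  by apply: noi; exists i'.
case: m nm i0m => // m nm i0m.
pose d := M i0 n.
pose M' i j := d * M (bump i0 i) j - M (bump i0 i) n * M i0 j.
have [c' [i im ci] cM'] := IHn m M' nm.
(* The coefficient at the pivot row [i0] is chosen so that combining the rows of [M] by [c] equals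
   combining those of [M'] by [c']; column [n] of [M'] is zero. *)
pose c i := if i == i0 then - \sum_(i < m) c' i * M (bump i0 i) n
            else d * c' (unbump i0 i).
have cb j : c (bump i0 j) = d * c' j.
  by rewrite /c eq_sym (negPf (neq_bump _ _)) bumpK.
exists c.
  exists (bump i0 i); last by rewrite cb; exact: prime_mulN.
  by rewrite /bump; case: (leqP i0 i) => /= _; rewrite ?add1n ?add0n ltnS // ltnW.
move=> j jn.
have -> : \sum_(i < m.+1) c i * M i j = \sum_(i < m) c' i * M' i j.
  rewrite (bigD1_ord (Ordinal i0m))//= {1}/c eqxx mulNr mulr_suml addrC.
  rewrite -sumrB; apply: eq_bigr => l _ /=.
  by rewrite cb /M'; ring.
move: jn; rewrite ltnS leq_eqVlt => /predU1P[->|/cM'//].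
apply: ideal_sum => // l _.
by rewrite /M' -/d (mulrC d) subrr mulr0; exact: ideal0.
Qed.

(** * Linear combinations, spans and independence over [S / q], modulo an ideal *)

Section Combinations.
Variables (S T : comPzRingType) (f : {rmorphism S -> T}).
Implicit Types (c : nat -> S) (u v : seq T) (x y : T) (Z : set T).

Definition comb c u : T := \sum_(i < size u) f (c i) * nth 0 u i.

Lemma comb_nil c : comb c [::] = 0. Proof. by rewrite /comb big_ord0. Qed.

Lemma comb_cons c x u : comb c (x :: u) = f (c 0%N) * x + comb (fun i => c i.+1) u.
Proof. by rewrite /comb big_ord_recl. Qed.

Lemma comb_cat c u v :
  comb c (u ++ v) = comb c u + comb (fun i => c (size u + i)%N) v.
Proof.
elim: u c => [|x u IHu] c; first by rewrite comb_nil add0r.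
by rewrite cat_cons !comb_cons IHu addrA.
Qed.

Lemma comb_mul c y u : comb c [seq y * x | x <- u] = y * comb c u.
Proof.
elim: u c => [|x u IHu] c /=; first by rewrite !comb_nil mulr0.
by rewrite !comb_cons IHu mulrDr mulrCA.
Qed.

Lemma combD c c' u : comb (fun i => c i + c' i) u = comb c u + comb c' u.
Proof.
by rewrite /comb -big_split; apply: eq_bigr => i _; rewrite rmorphD mulrDl.
Qed.

Lemma combZ a c u : comb (fun i => a * c i) u = f a * comb c u.
Proof.
by rewrite /comb mulr_sumr; apply: eq_bigr => i _; rewrite rmorphM mulrA.
Qed.

Lemma comb_mem u x : x \in u -> exists c, comb c u = x.
Proof.
elim: u => // y u IHu; rewrite inE => /predU1P[->|/IHu[c <-]].
  exists (fun i => (i == 0%N)%:R); rewrite comb_cons rmorph1 mul1r.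
  by rewrite /comb big1 ?addr0// => i _; rewrite rmorph0 mul0r.
by exists (fun i => if i is j.+1 then c j else 0); rewrite comb_cons rmorph0 mul0r add0r.
Qed.

Definition spanned Z u y := exists c, Z (y - comb c u).

Section Spanned.
Variables (Z : set T) (iZ : is_ideal Z).

Lemma spanned_ideal u y : Z y -> spanned Z u y.
Proof.
exists (fun=> 0); rewrite /comb big1 ?subr0// => i _.
by rewrite rmorph0 mul0r.
Qed.

Lemma spannedD u x y : spanned Z u x -> spanned Z u y -> spanned Z u (x + y).
Proof.
move=> [c Zc] [d Zd]; exists (fun i => c i + d i).
by rewrite combD opprD addrACA; exact: idealD.
Qed.

Lemma spannedZ u a x : spanned Z u x -> spanned Z u (f a * x).
Proof. by move=> [c Zc]; exists (fun i => a * c i); rewrite combZ -mulrBr; exact: idealM. Qed.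

Lemma spanned_mem u x : x \in u -> spanned Z u x.
Proof. by move=> /comb_mem[c <-]; exists c; rewrite subrr; exact: ideal0. Qed.

Lemma spanned_sum (I : eqType) (r : seq I) (F : I -> T) u :
  (forall i, i \in r -> spanned Z u (F i)) -> spanned Z u (\sum_(i <- r) F i).
Proof.
move=> FZ; rewrite big_seq; apply: big_ind => // [|x y].
  exact: spanned_ideal (ideal0 iZ).
exact: spannedD.
Qed.

Lemma spanned_comb u v c : (forall y, y \in u -> spanned Z v y) -> spanned Z v (comb c u).
Proof.
elim: u c => [|x u IHu] c uv; first by rewrite comb_nil; exact: spanned_ideal (ideal0 iZ).
rewrite comb_cons; apply: spannedD; first by apply/spannedZ/uv; rewrite mem_head.
by apply: IHu => y yu; apply: uv; rewrite inE yu orbT.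
Qed.

Lemma spanned_trans u v x :
  (forall y, y \in u -> spanned Z v y) -> spanned Z u x -> spanned Z v x.
Proof.
move=> uv [c Zc]; rewrite -[x](subrK (comb c u)).
by apply: spannedD; [exact: spanned_ideal|exact: spanned_comb].
Qed.

End Spanned.

Section Free.
Variables (q : prime_ideal S) (Z : set T).
Hypotheses (iZ : is_ideal Z) (qZ : forall a, prime_set q a -> Z (f a)).

(* Linear independence, modulo [Z], over the domain [S / q]. *)
Definition free_mod (Z : set T) u :=
  forall c, Z (comb c u) -> forall i, (i < size u)%N -> prime_set q (c i).

(** Greedy choice of a basis over the fraction field of [S / q], with denominators cleared: an
    element is kept only if no multiple of it by some [a] outside [q] is spanned by those already
    kept. *)
Lemma free_mod_submask (l : seq T) : exists m : bitseq, free_mod Z (mask m l) /\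
  forall x, x \in l -> exists2 a, ~ prime_set q a & spanned Z (mask m l) (f a * x).
Proof.
elim: l => [|x l [m [fm ml]]]; first by exists [::]; split=> // c _ i.
have [[a qa ax]|nx] := pselect (exists2 a, ~ prime_set q a & spanned Z (mask m l) (f a * x)).
  exists (false :: m); split=> // y; rewrite inE => /predU1P[->|/ml//].
  by exists a.
exists (true :: m) => /=; split=> [c|y].
  rewrite comb_cons => Zc.
  have qc0 : prime_set q (c 0%N).
    apply: contrapT => qc0; apply: nx; exists (c 0%N) => //.
    exists (fun i => - c i.+1); suff -> : comb (fun i => - c i.+1) (mask m l) =
      - comb (fun i => c i.+1) (mask m l) by rewrite opprK.
    by rewrite /comb -sumrN; apply: eq_bigr => i _; rewrite rmorphN mulNr.
  case=> [//|i /= im]; apply: (fm (fun i => c i.+1)) => //.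
  by apply: idealDl Zc => //; apply: idealMr => //; exact: qZ.
rewrite inE => /predU1P[->|/ml[a qa ay]].
  exists 1; first exact: prime_not1.
  by rewrite rmorph1 mul1r; apply: spanned_mem => //; rewrite mem_head.
exists a => //; apply: spanned_trans ay => // z zl.
by apply: spanned_mem => //; rewrite inE zl orbT.
Qed.

(** If [v] were longer, the matrix expressing [v] through [u] would have a nonzero kernel vector
    modulo [q], hence a forbidden relation on [v]. *)
Lemma free_mod_size u v : free_mod Z v -> (forall y, y \in v -> spanned Z u y) ->
  (size v <= size u)%N.
Proof.
move=> fv vu; rewrite leqNgt; apply/negP => uv.
have /choice[M MP] : forall i, exists c, (i < size v)%N -> Z (nth 0 v i - comb c u).
  move=> i; have [iv|_] := boolP (i < size v)%N; last by exists (fun=> 0).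
  by have [c Zc] := vu _ (mem_nth 0 iv); exists c.
have [c [i iv ci] cM] := prime_ideal_kernel q M uv.
apply/ci/(fv c) => //.
have -> : comb c v = \sum_(i < size v) f (c i) * (nth 0 v i - comb (M i) u) +
    \sum_(j < size u) f (\sum_(i < size v) c i * M i j) * nth 0 u j.
  have vE l : f (c l) * nth 0 v l =
      f (c l) * (nth 0 v l - comb (M l) u) + f (c l) * comb (M l) u.
    by rewrite -mulrDr subrK.
  rewrite {1}/comb; under eq_bigr do rewrite vE.
  rewrite big_split; congr (_ + _).
  under eq_bigr do rewrite /comb mulr_sumr.
  rewrite exchange_big; apply: eq_bigr => j _ /=.
  rewrite rmorph_sum mulr_suml; apply: eq_bigr => l _.
  by rewrite rmorphM mulrA.
apply: idealD => //; apply: ideal_sum => // l _.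
  by apply: idealM => //; exact: MP.
by apply: idealMr => //; apply/qZ/cM.
Qed.

Lemma common_denominator u (l : seq T) :
  (forall x, x \in l -> exists2 a, ~ prime_set q a & spanned Z u (f a * x)) ->
  exists2 a, ~ prime_set q a & forall x, x \in l -> spanned Z u (f a * x).
Proof.
elim: l => [|x l IHl] lu; first by exists 1 => //; exact: prime_not1.
have [y yl|a qa al] := IHl; first by apply: lu; rewrite inE yl orbT.
have [b qb bx] := lu _ (mem_head x l).
exists (b * a); first exact: prime_mulN.
move=> y; rewrite rmorphM inE => /predU1P[->|/al ay].
  by rewrite mulrAC mulrC; exact: spannedZ.
by rewrite -mulrA; exact: spannedZ.
Qed.

End Free.

End Combinations.

(** * Counting monomials, and polynomial growth *)

Section Monomials.
Variable A : comPzRingType.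

Fixpoint monomials (l : seq A) (m : nat) : seq A :=
  if l is a :: l' then [seq a ^+ j * x | j <- iota 0 m.+1, x <- monomials l' m]
  else [:: 1].

Lemma size_monomials l m : size (monomials l m) = (m.+1 ^ size l)%N.
Proof. by elim: l => //= a l IHl; rewrite (size_allpairs _ (iota 0 m.+1)) size_iota IHl expnS. Qed.

Lemma monomials_consP a l m x :
  x \in monomials (a :: l) m <->
  exists j y, [/\ (j <= m)%N, y \in monomials l m & x = a ^+ j * y].
Proof.
split=> [/allpairsP[[j y] []]|[j [y [jm yl ->]]]].
  by rewrite mem_iota => jm yl ->; exists j, y.
by apply/allpairsP; exists (j, y); split=> //; rewrite mem_iota.
Qed.

Lemma monomials_widen l m x : x \in monomials l m -> x \in monomials l m.+1.
Proof.
elim: l x => // a l IHl x /monomials_consP[j [y [jm yl ->]]].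
by apply/monomials_consP; exists j, y; rewrite leqW// IHl.
Qed.

Lemma monomials_mul l m a x :
  a \in l -> x \in monomials l m -> a * x \in monomials l m.+1.
Proof.
elim: l x => // b l IHl x; rewrite inE => al /monomials_consP[j [y [jm yl ->]]].
apply/monomials_consP; case/predU1P: al => [->|al].
  by exists j.+1, y; rewrite mulrA exprS monomials_widen.
by exists j, (a * y); rewrite leqW// IHl// mulrCA.
Qed.

Lemma monomials0 l : 1 \in monomials l 0.
Proof.
elim: l => [|a l IHl]; first by rewrite mem_head.
by apply/monomials_consP; exists 0%N, 1; rewrite expr0 mul1r.
Qed.

End Monomials.

Lemma sum_bin_diag (d m : nat) :
  (\sum_(j < m.+1) 'C(j + d, d) = 'C(m + d.+1, d.+1))%N.
Proof.
elim: m => [|m IHm]; first by rewrite big_ord1 !add0n !binn.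
by rewrite big_ord_recr IHm addSn binS /= addSnnS.
Qed.

Lemma bin_lower_bound (d m : nat) : (m.+1 ^ d <= 'C(m + d, d) * d`!)%N.
Proof.
elim: d => [|d IHd]; first by rewrite bin0.
rewrite factS mulnA [('C(_, _) * _)%N]mulnC -mul_bin_diag addnS /= -mulnA expnS.
by apply: leq_mul => //; rewrite ltnS leq_addr.
Qed.

(* Summing over [m] raises the degree of a polynomial bound, so the hypothesis
   makes [b] grow faster than every polynomial. *)
Lemma superpolynomial_growth (b : nat -> nat) (c t : nat) : (0 < b 0)%N ->
  (forall m, \sum_(j < m.+1) b j <= c * b m)%N ->
  ~ (forall m, b m <= m.+1 ^ t)%N.
Proof.
move=> b0 bc bt.
(* Each use of the hypothesis sums a binomial lower bound along a diagonal, raising its degree by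
   one. The induction starts from [b m > 0], which [bc] forces since [b 0 > 0]. *)
have bd d m : ('C(m + d, d) <= c ^ d * b m)%N.
  elim: d m => [|d IHd] m.
    rewrite bin0 expn0 mul1n lt0n; apply/eqP => bm0.
    by have := bc m; rewrite bm0 muln0 big_ord_recl leqn0 addn_eq0 -leqn0 leqNgt b0.
  rewrite -sum_bin_diag expnSr -mulnA; apply: leq_trans (leq_mul (leqnn _) (bc m)).
  by rewrite big_distrr; apply: leq_sum => j _; exact: IHd.
(* With this [m] the bounds give [m.+1 ^ t.+1 <= m * b m <= m * m.+1 ^ t], which is absurd. *)
pose m := (c ^ t.+1 * (t.+1)`!)%N.
have := leq_trans (bin_lower_bound t.+1 m) (leq_mul (bd t.+1 m) (leqnn _)).
rewrite mulnAC -/m expnS leqNgt => /negP; apply.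
apply: leq_ltn_trans (leq_mul (leqnn m) (bt m)) _.
by rewrite ltn_pmul2r ?expn_gt0.
Qed.

(** * A prime inside the colon prime [Q] with the same contractions is equal to it *)

Section Incomparability.
Variables (k : fieldType) (A B : comAlgType k).
Local Notation R := (tensor A B).
Local Notation inl := (tensor_inl A B).
Local Notation inr := (tensor_inr A B).

(** With this prime, [free_mod] over [in_alg A] is ordinary [k]-linear independence modulo an ideal
    of [A]. *)
Definition zero_prime : prime_ideal k.
Proof.
apply: (@PrimeIdeal k [set 0]).
- split=> [//|_ _ -> ->|a _ ->]; first by rewrite /= addr0.
  by rewrite /= mulr0.
- by move/eqP; rewrite oner_eq0.
- by move=> x y /eqP; rewrite mulf_eq0 => /orP[] /eqP; [left|right].
Defined.

Variables (p : prime_ideal A) (q : prime_ideal B) (V : set A) (W : set B).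
Hypotheses (iV : is_ideal V) (iW : is_ideal W).
Hypothesis regV : forall a x, ~ prime_set p a -> V (a * x) -> V x.
Variables (g : R) (Q P : prime_ideal R).
Hypothesis QE : forall x, prime_set Q x <-> ext_sum V W (x * g).
Hypotheses (Qq : forall b, prime_set Q (inr b) -> prime_set q b).
Hypotheses (pP : forall a, prime_set p a -> prime_set P (inl a)).
Hypotheses (qP : forall b, prime_set q b -> prime_set P (inr b)).
Hypothesis PQ : P `<=` Q.

Let iP := prime_is_ideal P.
Let iQ := prime_is_ideal Q.

Lemma comb_inl c (u : seq A) :
  inl (comb (in_alg A) c u) = comb inr (fun i => (c i)%:A) [seq inl x | x <- u].
Proof.
elim: u c => [|x u IHu] c /=; first by rewrite !comb_nil rmorph0.
by rewrite !comb_cons rmorphD rmorphM /= IHu inl_scale.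
Qed.

Section Witness.
Variables (s : R) (ls lg : seq (A * B)).
Hypotheses (Qs : prime_set Q s) (Ps : ~ prime_set P s).
Hypotheses (sE : s = tsum ls) (gE : g = tsum lg).

Let mono m := monomials [seq x.1 | x <- ls] m.

(** [size X] is the rank [b(m)] of the counting argument. A single denominator [b] serves all
    monomials, so that one functional can later treat them together. *)
Definition free_basis m (X : seq A) : Prop :=
  [/\ {subset X <= mono m}, (size X <= size (mono m))%N,
   free_mod inr q Q [seq inl x | x <- X] &
   exists2 b, ~ prime_set q b & forall x, x \in mono m ->
     spanned inr Q [seq inl x | x <- X] (inr b * inl x)].

Lemma free_basis_exists m : exists X, free_basis m X.
Proof.
have [b [fb /(common_denominator iQ)[a qa aP]]] :=
  free_mod_submask iQ (fun b qb => PQ (qP qb)) [seq inl x | x <- mono m].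
exists (mask b (mono m)); split; rewrite -?map_mask//.
- by move=> x /mem_mask.
- exact/size_subseq/mask_subseq.
- by rewrite map_mask.
- by exists a => // x xm; rewrite map_mask; apply: aP; apply: map_f.
Qed.

(** The first components of [s] are among the variables, so multiplication by [s] raises exponents
    by at most one. *)
Lemma span_mul_witness m y : spanned inr P [seq inl x | x <- mono m] y ->
  spanned inr P [seq inl x | x <- mono m.+1] (s * y).
Proof.
move=> [d Pd]; rewrite -[y](subrK (comb inr d [seq inl x | x <- mono m])) mulrDr.
apply: spannedD => //; first by apply: spanned_ideal; exact: idealM.
rewrite -comb_mul; apply: spanned_comb => // _ /mapP[_ /mapP[x xm ->] ->].
rewrite sE tsumE mulr_suml; apply: spanned_sum => // z zs.
rewrite mulrAC -rmorphM mulrC; apply: spannedZ => //.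
by apply/spanned_mem/map_f/monomials_mul => //; exact: map_f.
Qed.

(** A relation modulo [P] is first read modulo [Q], where [s] vanishes: the coefficients on [X] lie
    in [q], hence in [P]. What remains is [s] times a combination of [Y], and [s] cancels modulo
    [P]. *)
Lemma free_mod_cat (X Y : seq R) : free_mod inr q Q X -> free_mod inr q P Y ->
  free_mod inr q P (X ++ [seq s * y | y <- Y]).
Proof.
move=> fX fY c; rewrite comb_cat comb_mul => Pc.
have qX i : (i < size X)%N -> prime_set q (c i).
  by apply: fX; apply: (idealDr iQ _ (PQ Pc)); exact: idealMr.
have PX : prime_set P (comb inr c X).
  by apply: (ideal_sum _ iP) => i _; apply: (idealMr _ iP); exact/qP/qX.
have /prime_mul[//|/fY qY] : prime_set P (s * comb inr (fun i => c (size X + i)%N) Y).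
  exact: (idealDl iP PX Pc).
move=> i; rewrite size_cat size_map; have [/qX//|Xi] := ltnP i (size X).
by move=> iXY; rewrite -(subnKC Xi); apply: qY; rewrite ltn_subLR.
Qed.

(** The family consists of the layers [X m], [s * X (m - 1)], ..., [s ^ m * X 0]. *)
Lemma free_powers (X : nat -> seq A) m : (forall m, free_basis m (X m)) ->
  exists Y : seq R, [/\ size Y = (\sum_(j < m.+1) size (X j))%N,
    free_mod inr q P Y & forall y, y \in Y -> spanned inr P [seq inl x | x <- mono m] y].
Proof.
move=> XB.
have Xm j y : y \in [seq inl x | x <- X j] -> spanned inr P [seq inl x | x <- mono j] y.
  by case: (XB j) => sX _ _ _ /mapP[x /sX xm ->]; apply/spanned_mem/map_f.
elim: m => [|m [Y [sY fY Ym]]].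
  exists [seq inl x | x <- X 0%N]; split; last exact: Xm.
    by rewrite big_ord1 size_map.
  by case: (XB 0%N) => _ _ fX _ c /PQ; exact: fX.
exists ([seq inl x | x <- X m.+1] ++ [seq s * y | y <- Y]); split.
- by rewrite size_cat !size_map sY [RHS]big_ord_recr addnC.
- by apply: free_mod_cat => //; case: (XB m.+1).
- move=> y; rewrite mem_cat => /orP[/Xm//|/mapP[z /Ym zm ->]].
  exact: span_mul_witness.
Qed.

(* The contraction by [psi] turns the [B]-linear relations between the multiples
   [x * g], [x] a monomial, into [k]-linear relations between the [x * e]. *)
Lemma free_mod_size_basis m X (w : seq A) : free_basis m X ->
  {subset w <= mono m} -> free_mod (in_alg A) zero_prime p w ->
  (size w <= size lg * size X)%N.
Proof.
move=> [_ _ _ [b qb bX]] wm fw.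
have nbg : ~ ext_sum V W (inr b * g) by move=> /QE/Qq.
have [psi psiW Ve] : exists2 psi : {scalar B}, (forall z, W z -> psi z = 0) &
    ~ V (contract_right psi (inr b * g)).
  apply: contrapT => nopsi; apply/nbg/ext_sum_contract_right => // psi psiW.
  by apply: contrapT => Ve; apply: nopsi; exists psi.
set e := contract_right _ _ in Ve.
(* Modulo [V], these elements span all products of [e] with monomials. Multiplication by [e] keeps
   [w] independent: elements outside [p] are nonzerodivisors modulo [V], and [e] is not in [V]. *)
pose u := [seq x * z.1 | z <- lg, x <- X].
rewrite -(size_map ( *%R e) w).
have -> : (size lg * size X)%N = size u by rewrite size_allpairs.
apply: (@free_mod_size _ _ (in_alg A) zero_prime V) => //.
- by move=> _ ->; rewrite rmorph0; exact: ideal0.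
- move=> c; rewrite comb_mul size_map => Vc; apply: fw.
  apply: contrapT => /regV Vreg; apply/Ve/Vreg.
  by rewrite mulrC.
move=> _ /mapP[x /wm/bX[c Qc] ->].
set y := comb _ _ _ in Qc.
have -> : e * x = contract_right psi ((inr b * inl x - y) * g) + contract_right psi (y * g).
  by rewrite -contract_rightD -mulrDl subrK /e mulrC -contract_right_inl mulrCA mulrA.
apply: spannedD => //.
  apply: spanned_ideal; move/QE: Qc => /(ext_sum_contract_right _ iV iW); exact.
rewrite /y /comb mulr_suml contract_right_sum size_map; apply: spanned_sum => // i _.
rewrite gE tsumE mulr_sumr contract_right_sum; apply: spanned_sum => // z zg.
rewrite (nth_map 0)//.
have -> : inr (c i) * inl (nth 0 X i) * (inl z.1 * inr z.2) =
    tsum [:: (nth 0 X i * z.1, c i * z.2)].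
  by rewrite tsum1 !rmorphM; ring.
rewrite contract_right_tsum big_seq1 /= -mulr_algl; apply: spannedZ => //.
apply: spanned_mem => //; apply/allpairsP; exists (z, nth 0 X i); split=> //=.
exact: mem_nth.
Qed.

(** A [k]-basis [w], modulo [p], of the span of the monomials mediates: it spans the independent
    family of [free_powers] modulo [P], because [p] lies in [P], and [free_mod_size_basis] bounds
    its size. *)
Lemma basis_size_sum (X : nat -> seq A) m : (forall m, free_basis m (X m)) ->
  (\sum_(j < m.+1) size (X j) <= size lg * size (X m))%N.
Proof.
move=> XB; have [Y [<- fY Ym]] := free_powers m XB.
have [b [fw wm]] := @free_mod_submask _ _ (in_alg A) zero_prime p (prime_is_ideal p)
  (fun a a0 => eq_ind_r (fun a => prime_set p a%:A)
     (eq_ind_r (prime_set p) (ideal0 (prime_is_ideal p)) (scale0r _)) a0) (mono m).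
set w := mask b _ in fw wm.
apply: leq_trans (free_mod_size_basis (XB m) (fun x => @mem_mask _ x b _) fw).
rewrite -(size_map inl w); apply: free_mod_size fY _ => // y /Ym.
apply: spanned_trans => // _ /mapP[x /wm[a a0 [c pc]] ->].
have {}a0 : a != 0 by apply/eqP.
exists (fun i => (a^-1 * c i)%:A).
rewrite -comb_inl -rmorphB; apply: pP.
have -> : x - comb (in_alg A) (fun i => a^-1 * c i) w =
    a^-1%:A * (a%:A * x - comb (in_alg A) c w).
  by rewrite combZ /= mulrBr mulrA (mulr_algl a^-1 a%:A) scalerA mulVf// scale1r mul1r.
by apply: idealM => //; exact: prime_is_ideal.
Qed.

Lemma witness_false : False.
Proof.
have /choice[X XB] := free_basis_exists.
apply: (@superpolynomial_growth (fun m => size (X m)) (size lg) (size ls)).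
- have [_ _ _ [b qb bX]] := XB 0%N.
  rewrite lt0n; apply/eqP => /size0nil X0; move: bX.
  rewrite X0 => /(_ 1 (monomials0 _))[c]; rewrite comb_nil rmorph1 mulr1 subr0.
  by move/Qq.
- by move=> m; exact: basis_size_sum.
- move=> m; have [_ + _ _] := XB m.
  by rewrite size_monomials size_map.
Qed.

End Witness.

Lemma colon_prime_incomparable : Q `<=` P.
Proof.
move=> s Qs; apply: contrapT => Ps.
have [[ls sE] [lg gE]] := conj (tsumP s) (tsumP g).
exact: witness_false Qs Ps sE gE.
Qed.

End Incomparability.

(** * Symbolic powers of sums *)

Section SymbolicPowers.
Variables (k : fieldType) (A B : comAlgType k).
Hypotheses (noethA : noetherian A) (noethB : noetherian B).
Hypothesis noethR : noetherian (tensor A B).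
Local Notation R := (tensor A B).
Local Notation inl := (tensor_inl A B).
Local Notation inr := (tensor_inr A B).
Variables (I : set A) (J : set B).
Hypotheses (iI : is_ideal I) (iJ : is_ideal J).
Local Notation IJ := (ext_sum I J).

(* Going down: the elements [inl s * u] with [s] outside [p] and [u] outside [P]
   avoid the extension of [p] and [J], because [A / p -> A / p (x) B / J] is flat. *)
Lemma contraction_minimal_left P :
  minimal_primes IJ P -> minimal_primes I (contraction inl P).
Proof.
move=> [IJP Pmin]; split=> [a Ia|p Ip pP].
  exact: (IJP _ (ext_sum_subl _ (ideal_ext_sub Ia))).
apply/seteqP; split=> // a Pa; apply: contrapT => pa.
pose X := [set x | exists2 s, ~ prime_set p s & exists2 u, ~ prime_set P u & x = inl s * u].
have ipJ := ext_sum_ideal p J.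
have pJP : ext_sum p J `<=` P.
  apply: ideal_add_min; first exact: prime_is_ideal.
    by apply: ideal_ext_min => // ; exact: prime_is_ideal.
  by apply: subset_trans IJP; exact: ext_sum_subr.
have [|||P' [pJP' P'X]] := @prime_avoiding _ noethR (ext_sum p J) X ipJ.
- exists 1; first exact: prime_not1.
  by exists 1; [exact: prime_not1|rewrite rmorph1 mulr1].
- move=> _ _ [s ps [u Pu ->]] [t pt [v Pv ->]]; exists (s * t); first exact: prime_mulN.
  by exists (u * v); [exact: prime_mulN|rewrite rmorphM mulrACA].
- move=> _ [s ps [u Pu ->]] /(ext_sum_regular_left (prime_is_ideal p) iJ) su.
  by apply/Pu/pJP/su => x /prime_mul[].
have P'P : P' `<=` P.
  move=> u P'u; apply: contrapT => Pu; apply: (P'X u) => //.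
  exists 1; first exact: prime_not1.
  by exists u => //; rewrite rmorph1 mul1r.
apply: (P'X (inl a)).
  exists a => //; exists 1; first exact: prime_not1.
  by rewrite mulr1.
rewrite (Pmin P')//; apply: subset_trans pJP'.
by apply: ideal_add_mono => //; exact: ideal_ext_mono.
Qed.

Lemma contraction_minimal_right P :
  minimal_primes IJ P -> minimal_primes J (contraction inr P).
Proof.
move=> [IJP Pmin]; split=> [b Jb|q Jq qP].
  exact: (IJP _ (ext_sum_subr _ (ideal_ext_sub Jb))).
apply/seteqP; split=> // b Pb; apply: contrapT => qb.
pose X := [set x | exists2 s, ~ prime_set q s & exists2 u, ~ prime_set P u & x = inr s * u].
have iIq := ext_sum_ideal I q.
have IqP : ext_sum I q `<=` P.
  apply: ideal_add_min; first exact: prime_is_ideal.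
    by apply: subset_trans IJP; exact: ext_sum_subl.
  by apply: ideal_ext_min => // ; exact: prime_is_ideal.
have [|||P' [IqP' P'X]] := @prime_avoiding _ noethR (ext_sum I q) X iIq.
- exists 1; first exact: prime_not1.
  by exists 1; [exact: prime_not1|rewrite rmorph1 mulr1].
- move=> _ _ [s qs [u Pu ->]] [t qt [v Pv ->]]; exists (s * t); first exact: prime_mulN.
  by exists (u * v); [exact: prime_mulN|rewrite rmorphM mulrACA].
- move=> _ [s qs [u Pu ->]] /(ext_sum_regular_right iI (prime_is_ideal q)) su.
  by apply/Pu/IqP/su => x /prime_mul[].
have P'P : P' `<=` P.
  move=> u P'u; apply: contrapT => Pu; apply: (P'X u) => //.
  exists 1; first exact: prime_not1.
  by exists u => //; rewrite rmorph1 mul1r.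
apply: (P'X (inr b)).
  exists b => //; exists 1; first exact: prime_not1.
  by rewrite mulr1.
rewrite (Pmin P')//; apply: subset_trans IqP'.
by apply: ideal_add_mono => //; exact: ideal_ext_mono.
Qed.

(** A multiplier outside the contraction of [P] maps to a multiplier outside [P]. *)
Lemma ext_symbolic_power_sub (S T : comPzRingType) (f : {rmorphism S -> T})
    (L : set S) (P : prime_ideal T) i : minimal_primes L (contraction f P) ->
  ideal_ext f (symbolic_power L i) `<=` saturation P (ideal_exp (ideal_ext f L) i).
Proof.
case: i => [|i] Lmin; first by move=> x _; exact: saturation_sub.
apply: ideal_ext_min; first by apply: saturation_ideal; exact: ideal_exp_ideal.
rewrite symbolic_powerE// => x /(_ _ Lmin)[s Ps sx].
by exists (f s) => //; rewrite -rmorphM; exact: ideal_exp_ext.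
Qed.

Lemma symbolic_power_mul_sub i j : (0 < i + j)%N ->
  ideal_mul (ideal_ext inl (symbolic_power I i)) (ideal_ext inr (symbolic_power J j))
    `<=` symbolic_power IJ (i + j).
Proof.
move=> ij; apply: ideal_mul_min => [|x y Ix Jy]; first exact: symbolic_power_ideal.
rewrite symbolic_powerE// => P minP.
have [s Ps sx] := ext_symbolic_power_sub (contraction_minimal_left minP) Ix.
have [t Pt ty] := ext_symbolic_power_sub (contraction_minimal_right minP) Jy.
exists (s * t); first exact: prime_mulN.
rewrite mulrACA; apply: ideal_exp_mul.
  by apply: ideal_exp_mono sx; exact: ext_sum_subl.
by apply: ideal_exp_mono ty; exact: ext_sum_subr.
Qed.

Lemma saturation_exp_radical (S : comPzRingType) (noethS : noetherian S) (L : set S)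
    (p : prime_ideal S) i a : is_ideal L -> minimal_primes L p -> prime_set p a ->
  exists n, saturation p (ideal_exp L i) (a ^+ n).
Proof.
move=> iL minp pa; have [s ps [n Lsa]] := minimal_prime_radical noethS iL minp pa.
exists (n * i)%N; exists (s ^+ i); first by move/primeX.
by rewrite exprM -exprMn; exact: expr_ideal_exp.
Qed.

(* The colon ideal [Q] below is a prime contracting to [p] and [q], and it is
   minimal over [I + J] by [colon_prime_incomparable]. *)
Lemma symbolic_power_local n i j (p : prime_ideal A) (q : prime_ideal B) f :
  (0 < n)%N -> (i + j <= n.+1)%N -> minimal_primes I p -> minimal_primes J q ->
  symbolic_power IJ n f ->
  ext_sum (saturation p (ideal_exp I i)) (saturation q (ideal_exp J j)) f.
Proof.
move=> n0 ij minp minq If; apply: contrapT.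
set V := saturation p _; set W := saturation q _.
have iV : is_ideal V by apply: saturation_ideal; exact: ideal_exp_ideal.
have iW : is_ideal W by apply: saturation_ideal; exact: ideal_exp_ideal.
move=> /(colon_prime noethR (ext_sum_ideal V W))[g Ng [r gE [Q QE]]].
(* Some power of each element of [p] lies in [V], so [Q] contains [p]; elements outside [p] are
   nonzerodivisors modulo [V R + W R], so the contraction is no larger. The same holds for [q]. *)
have pQ a : prime_set p a -> prime_set Q (inl a).
  move=> /(saturation_exp_radical noethA i iI minp)[m Va]; apply: (@primeX _ _ _ m).
  apply/QE; rewrite -rmorphXn; apply: (idealMr _ (ext_sum_ideal V W)).
  by apply: ext_sum_subl; exact: ideal_ext_sub.
have qQ b : prime_set q b -> prime_set Q (inr b).
  move=> /(saturation_exp_radical noethB j iJ minq)[m Wb]; apply: (@primeX _ _ _ m).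
  apply/QE; rewrite -rmorphXn; apply: (idealMr _ (ext_sum_ideal V W)).
  by apply: ext_sum_subr; exact: ideal_ext_sub.
have Qp a : prime_set Q (inl a) -> prime_set p a.
  move=> /QE Na; apply: contrapT => pa; apply: Ng.
  by apply: ext_sum_regular_left Na => // x; exact: saturation_regular.
have Qq b : prime_set Q (inr b) -> prime_set q b.
  move=> /QE Nb; apply: contrapT => qb; apply: Ng.
  by apply: ext_sum_regular_right Nb => // x; exact: saturation_regular.
have minQ : minimal_primes IJ Q.
  split=> [|P IJP PQ].
    apply: ideal_add_min; first exact: prime_is_ideal.
      apply: ideal_ext_min => [|a Ia]; first exact: prime_is_ideal.
      exact/pQ/minp.1.
    apply: ideal_ext_min => [|b Jb]; first exact: prime_is_ideal.
    exact/qQ/minq.1.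
  have pP a : prime_set p a -> prime_set P (inl a).
    rewrite -(minp.2 (contraction inl P)) // => [a' Ia'|a' Pa'].
      exact: (IJP _ (ext_sum_subl _ (ideal_ext_sub Ia'))).
    exact/Qp/PQ.
  have qP b : prime_set q b -> prime_set P (inr b).
    rewrite -(minq.2 (contraction inr P)) // => [b' Jb'|b' Pb'].
      exact: (IJP _ (ext_sum_subr _ (ideal_ext_sub Jb'))).
    exact/Qq/PQ.
  apply/seteqP; split=> //; apply: (colon_prime_incomparable iV iW _ QE Qq pP qP) => //.
  by move=> a x; exact: saturation_regular.
move: If; rewrite symbolic_powerE// => /(_ _ minQ)[s Qs sf].
(* Since [s * f] is in the ordinary power of [I + J], it lies in [V R + W R]; then so does [s * g],
   which puts [s] in [Q]. *)
apply/Qs/QE; rewrite gE mulrCA; apply: (idealM _ (ext_sum_ideal V W)).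
have [x Ix [y Jy <-]] := ideal_add_exp_sub ij sf.
apply: (idealD (ext_sum_ideal V W)).
  apply: ext_sum_subl; apply: ideal_ext_mono (ideal_ext_exp Ix).
  exact: saturation_sub.
apply: ext_sum_subr; apply: ideal_ext_mono (ideal_ext_exp Jy).
exact: saturation_sub.
Qed.

(** Positive symbolic powers are intersections of saturations, which pull out of either argument of
    [ext_sum]; this leaves one pair of minimal primes at a time. *)
Lemma symbolic_power_ext_sum n i j f : (0 < n)%N -> (0 < i)%N -> (0 < j)%N ->
  (i + j <= n.+1)%N -> symbolic_power IJ n f ->
  ext_sum (symbolic_power I i) (symbolic_power J j) f.
Proof.
move=> n0 i0 j0 ij If.
have iS (S : comPzRingType) (L : set S) m p : is_ideal (saturation p (ideal_exp L m)).
  by apply: saturation_ideal; exact: ideal_exp_ideal.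
rewrite !symbolic_powerE//; apply: ext_sum_bigcap_left => [p||p minp]; first exact: iS.
  by apply: bigcap_ideal => q _; exact: iS.
apply: ext_sum_bigcap_right => [|q|q minq]; [exact: iS|exact: iS|].
exact: symbolic_power_local If.
Qed.

End SymbolicPowers.

(** * Sums of products of two decreasing filtrations *)

Section Filtrations.
Variables (k : fieldType) (A B : comAlgType k).
Local Notation inl := (tensor_inl A B).
Local Notation inr := (tensor_inr A B).
Variables (F : nat -> set A) (G : nat -> set B).
Hypotheses (iF : forall i, is_ideal (F i)) (iG : forall j, is_ideal (G j)).
Hypotheses (F0 : F 0%N = setT) (G0 : G 0%N = setT).
Hypotheses (decF : forall i, F i.+1 `<=` F i) (decG : forall j, G j.+1 `<=` G j).

Let FG n (i : 'I_n.+1) := ideal_mul (ideal_ext inl (F i)) (ideal_ext inr (G (n - i))).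

Lemma filtration_antimono (T : Type) (H : nat -> set T) i j :
  (forall i, H i.+1 `<=` H i) -> (i <= j)%N -> H j `<=` H i.
Proof.
move=> decH /subnK <-; elim: (j - i)%N => [//|m IHm].
by apply: subset_trans IHm; exact: decH.
Qed.

Lemma mem_sum_filtration n f :
  (forall i, (i < n)%N -> ext_sum (F i.+1) (G (n - i)) f) ->
  (\big[@ideal_add (tensor A B)/[set 0]]_(i < n.+1) FG i) f.
Proof.
move=> fFG; set Sg := \big[_/_]_(i < _) _.
have iFG (i : 'I_n.+1) : is_ideal (FG i) by exact: ideal_mul_ideal.
have iSg : is_ideal Sg by exact: sum_ideal_ideal.
(* The terms with [i <= m] lie in [G (n - m) R], the others in [F m.+1 R]. *)
have Sg_sub m : (m < n)%N -> Sg `<=` ext_sum (F m.+1) (G (n - m)).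
  move=> mn; have iE := ext_sum_ideal (F m.+1) (G (n - m)).
  apply: sum_ideal_min => // i; apply: ideal_mul_min => // x y Fx Gy.
  have [im|mi] := leqP i m.
    apply: (idealM _ iE); apply: ext_sum_subr.
    apply: ideal_ext_mono Gy; apply: filtration_antimono => //.
    exact: leq_sub2l.
  apply: (idealMr _ iE); apply: ext_sum_subl.
  by apply: ideal_ext_mono Fx; exact: filtration_antimono.
(* Successive approximation: the remainder lies in both [F m R] and [F m.+1 R + G (n - m) R], so the
   modular law moves it into [F m.+1 R] up to an element of term [m] of the sum. At [m = n] it lies
   in the last term, as [G 0] is the unit ideal. *)
have approx m : (m <= n)%N -> exists2 y, Sg y & ideal_ext inl (F m) (f - y).
  elim: m => [|m IHm] mn.
    exists 0; first exact: ideal0.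
    rewrite F0 -(mulr1 (f - 0)) -(rmorph1 inl).
    by apply: (idealM _ (ideal_ext_ideal _ _)); exact: ideal_ext_sub.
  have [y Sy Fy] := IHm (ltnW mn).
  have [|u Fu [v FGv uv]] := ext_sum_modular (iF m) (iF m.+1) (iG (n - m)) Fy.
    apply: (idealB (ext_sum_ideal _ _)); first exact: fFG.
    exact: Sg_sub.
  exists (y + v); last by rewrite opprD addrA -uv addrK.
  apply: idealD => //.
  exact: (sum_ideal_sub (i := Ordinal (ltnW mn : m < n.+1)%N) iFG).
have [y Sy Fy] := approx n (leqnn n); rewrite -(subrK y f); apply: idealD => //.
apply: (sum_ideal_sub (i := ord_max) iFG).
rewrite /FG /= subnn G0 -(mulr1 (f - y)) -(rmorph1 inr).
by apply: ideal_mulP => //; exact: ideal_ext_sub.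
Qed.

End Filtrations.

Theorem theorem3p4 (k : fieldType) (A B : comAlgType k)
    (noethA : noetherian A) (noethB : noetherian B)
    (noethR : noetherian (tensor A B))
    (I : set A) (idealI : is_ideal I) (I_neq0 : I <> [set 0]) (I_proper : I <> setT)
    (J : set B) (idealJ : is_ideal J) (J_neq0 : J <> [set 0]) (J_proper : J <> setT)
    (n : nat) (n_ge1 : (1 <= n)%N) :
  ((ideal_ext (tensor_inl A B) I + ideal_ext (tensor_inr A B) J)^(n) =
   \sum_(i < n.+1)
     ideal_ext (tensor_inl A B) I^(i) * ideal_ext (tensor_inr A B) J^(n - i))%I.
Proof.
apply/seteqP; split=> [f If|].
  apply: (mem_sum_filtration (F := symbolic_power I) (G := symbolic_power J)) => //.
  - by move=> i; exact: symbolic_power_ideal.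
  - by move=> i; exact: symbolic_power_ideal.
  - by move=> i; exact: symbolic_powerS_sub.
  - by move=> i; exact: symbolic_powerS_sub.
  (* The exponents [i + 1] and [n - i] are positive and add up to [n + 1]. *)
  move=> i i_n; apply: (symbolic_power_ext_sum noethA noethB noethR) If => //.
    by rewrite subn_gt0.
  by rewrite addSn subnKC// ltnW.
apply: sum_ideal_min => [|i]; first exact: symbolic_power_ideal.
have i_n : (i <= n)%N by rewrite -ltnS.
have := symbolic_power_mul_sub noethR idealI idealJ (i := i) (j := (n - i)%N).
by rewrite (subnKC i_n); apply.
Qed.
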